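(* There is an absolute constant $C$ such that the following holds. Let $2\le p<\infty$. Let $(\mathcal{M},\tau)$ be a von Neumann algebra with a normal faithful tracial state, $\mathcal{N}\subset\mathcal{M}$ a von Neumann subalgebra, and let $\mathcal{N}\subset A_j\subset\mathcal{M}$, $j=1,\dots,n$, be von Neumann subalgebras that are successively independent over $\mathcal{N}$. Let $a_j\in A_j$ be self-adjoint and let $\sigma_j,M_j\ge 0$ be real numbers such that for every $j$: (i) $E_{\mathcal{N}}(a_j)=0$; (ii) $E_{\mathcal{N}}(a_j^2)\le\sigma_j^2$; (iii) $\|a_j\|\le M_j$. Then $$\Big\|\sum_{j=1}^n a_j\Big\|_p\le C\left(\Big(p\sum_{j=1}^n\sigma_j^2\Big)^{1/2}+p\sup_{j=1,\dots,n}M_j\right).$$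
   Context: $\tau$ is a state with $\tau(1)=1$ and $\tau(xy)=\tau(yx)$; $\|x\|_p=[\tau(|x|^p)]^{1/p}$ is the norm of $L_p(\mathcal{M},\tau)$ and $\|\cdot\|$ is the operator norm. $E_{\mathcal{N}}:\mathcal{M}\to\mathcal{N}$ denotes the unique $\tau$-preserving conditional expectation: $E_{\mathcal{N}}(1)=1$ and $E_{\mathcal{N}}(axb)=aE_{\mathcal{N}}(x)b$ for $a,b\in\mathcal{N}$, $x\in\mathcal{M}$. Two subalgebras $\mathcal{N}\subset A,B\subset\mathcal{M}$ are independent over $\mathcal{N}$ if $E_{\mathcal{N}}(ab)=E_{\mathcal{N}}(a)E_{\mathcal{N}}(b)$ for all $a\in A$, $b\in B$. The subalgebras $A_1,\dots,A_n$ are successively independent over $\mathcal{N}$ if, for each $1\le k<n$, $A_{k+1}$ is independent over $\mathcal{N}$ of the algebra generated by $A_1,\dots,A_k$. *)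

(* Defs.v *)
From HB Require Import structures.
From mathcomp Require Import all_boot all_order all_algebra.
From mathcomp Require Import boolp classical_sets functions reals exp.
From mathcomp Require Import complex sesquilinear.

Set Implicit Arguments.
Unset Strict Implicit.
Unset Printing Implicit Defensive.

Import Order.TTheory GRing.Theory Num.Theory.
Local Open Scope classical_set_scope.
Local Open Scope ring_scope.
Local Open Scope complex_scope.

(* Operators are plain functions H -> H, with the pointwise lmodType structure
   of [functions]; the product is [\o] and the unit is [idfun]. Sets of operators
   are [set (H -> H)].  *)
Section Operators.
Context (R : realType) (H : lmodType R[i]) (ip : {dot H for Num.conj}).
Implicit Types (x y z : H -> H) (u v : H) (S D : set (H -> H)).

Definition hnorm u : R := Num.sqrt (complex.Re (ip u u)).

(* Completeness for [hnorm]: this makes (H, ip) a Hilbert space. *)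
Definition hilbert_complete : Prop :=
  forall f : nat -> H,
    (forall e : R, 0 < e ->
       exists K, forall m n, (K <= m)%N -> (K <= n)%N -> hnorm (f m - f n) <= e) ->
    exists l, forall e : R, 0 < e ->
       exists K, forall n, (K <= n)%N -> hnorm (f n - l) <= e.

Definition bounded_op x : Prop :=
  linear x /\ exists K : R, forall u, hnorm (x u) <= K * hnorm u.

(* Meaningful for bounded operators only: [sup] of an unbounded set is 0. *)
Definition opnorm x : R := sup [set hnorm (x u) | u in [set u | hnorm u <= 1]].

Definition is_adjoint x y : Prop := forall u v, ip (x u) v = ip u (y v).

Definition adj x : H -> H := xget 0 [set y | is_adjoint x y].

(* In R[i], [0 <= z] says that z is real and nonnegative, so [op_le x y] entails
   that y - x is self-adjoint. *)
Definition op_le x y : Prop := forall u, 0 <= ip ((y - x) u) u.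

Definition commutant S : set (H -> H) :=
  [set y | bounded_op y /\ forall x, S x -> x \o y = y \o x].

Definition von_neumann_algebra S : Prop :=
  [/\ forall x, S x -> bounded_op x,
      forall x, S x -> exists2 y, S y & is_adjoint x y
    & commutant (commutant S) = S].

Definition op_poly (q : {poly R}) x : H -> H :=
  \sum_(k < size q) (q`_k)%:C *: iter k (fun y => x \o y) idfun.

(* Continuous functional calculus for a self-adjoint operator x and a function f
   continuous on [-|x|, |x|], an interval which contains the spectrum of x: f(x)
   is the norm limit of q(x) for polynomials q tending to f uniformly there. *)
Definition is_fun_calc (f : R -> R) x y : Prop :=
  bounded_op y /\
  forall e : R, 0 < e -> exists q : {poly R},
    (forall t : R, `|t| <= opnorm x -> `|q.[t] - f t| <= e) /\
    opnorm (op_poly q x - y) <= e.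

Definition fun_calc (f : R -> R) x : H -> H := xget 0 [set y | is_fun_calc f x y].

Definition abs_op x : H -> H := fun_calc Num.sqrt (adj x \o x).

(* |x|^p. The absolute value on t is needed for continuity on [-|x|, |x|]: the
   library's [t `^ p] is 1 for t < 0. *)
Definition abs_pow (p : R) x : H -> H :=
  fun_calc (fun t => `|t| `^ p) (abs_op x).

Definition Lp_norm (tau : (H -> H) -> R[i]) (p : R) x : R :=
  complex.Re (tau (abs_pow p x)) `^ p^-1.

(* Only the values of tau on M matter. *)
Record normal_faithful_tracial_state (M : set (H -> H))
    (tau : (H -> H) -> R[i]) : Prop := {
  state_linear : forall (c : R[i]) x y, M x -> M y ->
    tau (c *: x + y) = c * tau x + tau y;
  state_pos : forall x, M x -> op_le 0 x -> 0 <= tau x;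
  state_one : tau idfun = 1;
  state_tracial : forall x y, M x -> M y -> tau (x \o y) = tau (y \o x);
  state_faithful : forall x, M x -> op_le 0 x -> tau x = 0 -> x = 0;
  (* tau (sup D) = sup (tau D) for upward directed sets D of positive operators *)
  state_normal : forall D s, D !=set0 ->
    (forall x, D x -> M x /\ op_le 0 x) ->
    (forall x y, D x -> D y -> exists z, [/\ D z, op_le x z & op_le y z]) ->
    M s -> (forall x, D x -> op_le x s) ->
    (forall z, M z -> (forall x, D x -> op_le x z) -> op_le s z) ->
    tau s = (sup [set complex.Re (tau x) | x in D])%:C }.

(* The tau-preserving conditional expectation of M onto N. It exists and is
   unique on M, and only its values on M matter. *)
Record conditional_expectation (M N : set (H -> H)) (tau : (H -> H) -> R[i])
    (E : (H -> H) -> H -> H) : Prop := {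
  cexp_in : forall x, M x -> N (E x);
  cexp_linear : forall (c : R[i]) x y, M x -> M y -> E (c *: x + y) = c *: E x + E y;
  cexp_pos : forall x, M x -> op_le 0 x -> op_le 0 (E x);
  cexp_one : E idfun = idfun;
  cexp_bimodule : forall a b x, N a -> N b -> M x ->
    E (a \o x \o b) = a \o E x \o b;
  cexp_state : forall x, M x -> tau (E x) = tau x }.

Definition independent (E : (H -> H) -> H -> H) (A B : set (H -> H)) : Prop :=
  forall a b, A a -> B b -> E (a \o b) = E a \o E b.

Definition unital_subalgebra S : Prop :=
  [/\ S idfun,
      forall (c : R[i]) x y, S x -> S y -> S (c *: x + y)
    & forall x y, S x -> S y -> S (x \o y)].

Definition generated_algebra (G : set (H -> H)) : set (H -> H) :=
  smallest unital_subalgebra G.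

(* Indices start at 0, so that k ranges over 1, ..., n - 1. *)
Definition successively_independent (E : (H -> H) -> H -> H) (n : nat)
    (A : 'I_n -> set (H -> H)) : Prop :=
  forall k : 'I_n, (0 < k)%N ->
    independent E (A k)
      (generated_algebra (\bigcup_(i in [set i : 'I_n | (i < k)%N]) A i)).

End Operators.

(* Main.v *)
Require Import Defs.
From HB Require Import structures.
From mathcomp Require Import all_boot all_order all_algebra.
From mathcomp Require Import boolp classical_sets functions reals sequences exp.
From mathcomp Require Import complex sesquilinear.
From mathcomp Require Import ring lra.

Set Implicit Arguments.
Unset Strict Implicit.
Unset Printing Implicit Defensive.

Import Order.TTheory GRing.Theory Num.Theory.
Local Open Scope classical_set_scope.
Local Open Scope ring_scope.
Local Open Scope complex_scope.

(** The theorem is Bernstein's inequality, and the proof is the Laplace transform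
    method: bound the exponential moments of the sum, integrate the summands out
    one at a time, and optimise the parameter.

    The exponential of a sum of noncommuting operators is not a product of
    exponentials; the Golden-Thompson inequality
    [tau (e^(a+b)) <= tau (e^a e^b)], a consequence of traciality and positivity,
    makes up for that. Polynomials can take the place of the exponential: for [N]
    a power of 2, [(1 + x / N) ^ N] ([dexp]) satisfies the same inequality up to
    an error [O (1 / N)] ([tr_dexp_add_le]).
    The heart of it is [trace_exp_pow2], which says that
    [tau ((a b) ^ N) <= tau (a ^ N b ^ N)] for self-adjoint [a] and [b], and the
    error is the distance from [1 + (a + b) / N] to [(1 + a / N) (1 + b / N)].

    Let [a] be the last summand and [x] the sum of the others, both multiplied
    by [lambda], with [|a| <= 1/2]. Then [(1 + a / N) ^ N <= 1 + a + 2 a^2], so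
    its conditional expectation is at most [1 + 2 lambda^2 sigma^2], because that
    of [a] vanishes. By independence the conditional expectation can replace [(1 + a / N) ^ N] in
    [tau ((1 + x / N) ^ N (1 + a / N) ^ N)]; as [(1 + x / N) ^ N] is a square,
    the last summand costs a factor [1 + 2 lambda^2 sigma^2]
    ([tr_mul_independent_le]). By induction the discrete exponential moment of
    the whole sum is at most [exp (2 lambda^2 V)] up to [O (1 / N)], where [V] is
    the sum of the [sigma_j ^ 2] ([tr_dexp_sum_le]).

    For [q] a power of 2 dividing [N],
    [(t / q) ^ q <= (1 + t / N) ^ N + (1 - t / N) ^ N] on the whole line, whence
    [tau (X ^ q) (lambda / q) ^ q <= 2 exp (2 lambda^2 V)] for the sum [X]
    ([moment_le_of_dexp]). Take [q] between [p] and [2 p] and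
    [lambda = p / (2 T)], where [T] is slightly above the right-hand side of the
    theorem without its constant: the [q]-th moment is at most
    [2 e^(p/2) (4 T) ^ q]. Finally [|t|^p <= K^p (1 + (t / K) ^ q)] with
    [K = 4 T] turns that into a bound on [tau (|X|^p)] ([Lp_bound]).

    Every scalar inequality passes to operators through one fact, [poly_nneg]: a
    real polynomial which is nonnegative on [-|y|, |y|] is nonnegative at the
    self-adjoint operator [y]. It is proved by writing a polynomial that is
    positive on an interval in terms of squares and of the two endpoint factors.
    The operators [|X|] and [|X|^p] are norm limits of such polynomials, and both
    the identity [|X|^2 = X^2] and the trace bounds pass to the limit. *)

(** * The real inner product and the operator norm *)

Section HilbertSpace.
Context (R : realType) (H : lmodType R[i]) (ip : {dot H for Num.conj}).
Implicit Types (u v w : H) (c : R[i]) (r : R).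

Definition rip u v : R := complex.Re (ip u v).

Lemma ipC u v : ip u v = (ip v u)^*.
Proof. by rewrite hermC expr0 mul1r. Qed.

Lemma ipDl u v w : ip (u + v) w = ip u w + ip v w.
Proof. by rewrite linearDl. Qed.

Lemma ipZl c u w : ip (c *: u) w = c * ip u w.
Proof. by rewrite linearZl_LR. Qed.

Lemma ipDr u v w : ip w (u + v) = ip w u + ip w v.
Proof. by rewrite linearDr. Qed.

Lemma ipZr c u w : ip w (c *: u) = c^* * ip w u.
Proof. by rewrite linearZr_LR. Qed.

Lemma ipBl u v w : ip (u - v) w = ip u w - ip v w.
Proof. by rewrite linearBl. Qed.

Lemma ipBr u v w : ip w (u - v) = ip w u - ip w v.
Proof. by rewrite linearBr. Qed.

Lemma ip0l w : ip 0 w = 0. Proof. by rewrite linear0l. Qed.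

Lemma ip_ge0 u : 0 <= ip u u.
Proof.
have [->|u0] := eqVneq u 0; first by rewrite ip0l.
exact/ltW/neq0_dnorm_gt0.
Qed.

Lemma ReD (x y : R[i]) : complex.Re (x + y) = complex.Re x + complex.Re y.
Proof. by case: x; case: y. Qed.

Lemma ReN (x : R[i]) : complex.Re (- x) = - complex.Re x.
Proof. by case: x. Qed.

Lemma ReZ r (x : R[i]) : complex.Re (r%:C * x) = r * complex.Re x.
Proof. by case: x => a b /=; rewrite mul0r subr0. Qed.

Lemma ripC u v : rip u v = rip v u.
Proof. by rewrite /rip ipC; case: (ip v u). Qed.

Lemma ripDl u v w : rip (u + v) w = rip u w + rip v w.
Proof. by rewrite /rip ipDl ReD. Qed.

Lemma ripDr u v w : rip w (u + v) = rip w u + rip w v.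
Proof. by rewrite /rip ipDr ReD. Qed.

Lemma ripBl u v w : rip (u - v) w = rip u w - rip v w.
Proof. by rewrite /rip ipBl ReD ReN. Qed.

Lemma ripBr u v w : rip w (u - v) = rip w u - rip w v.
Proof. by rewrite /rip ipBr ReD ReN. Qed.

Lemma ripZl r u w : rip (r%:C *: u) w = r * rip u w.
Proof. by rewrite /rip ipZl ReZ. Qed.

Lemma ripZr r u w : rip w (r%:C *: u) = r * rip w u.
Proof. by rewrite ripC ripZl ripC. Qed.

Lemma rip_ge0 u : 0 <= rip u u.
Proof. by have := ip_ge0 u; rewrite lecE => /andP[]. Qed.

Lemma ip_rip u : ip u u = (rip u u)%:C.
Proof.
have := ger0_Im (ip_ge0 u).
by rewrite /rip; case: (ip u u) => a b /= ->.
Qed.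

Lemma hnorm_ge0 u : 0 <= hnorm ip u.
Proof. exact: sqrtr_ge0. Qed.

Lemma hnorm_sq u : hnorm ip u ^+ 2 = rip u u.
Proof. by rewrite sqr_sqrtr // rip_ge0. Qed.

Lemma hnorm_eq0 u : hnorm ip u = 0 -> u = 0.
Proof.
move=> h; apply: contrapT => /eqP u0.
have := neq0_dnorm_gt0 (s := ip) _ u0.
by rewrite ip_rip -hnorm_sq h expr0n ltxx.
Qed.

Lemma hnorm0 : hnorm ip 0 = 0.
Proof. by rewrite /hnorm ip0l sqrtr0. Qed.

Lemma cauchy_schwarz u v : rip u v <= hnorm ip u * hnorm ip v.
Proof.
have [v0|v0] := eqVneq (hnorm ip v) 0.
  by rewrite (hnorm_eq0 v0) /rip linear0r hnorm0 mulr0.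
have vp : 0 < hnorm ip v by rewrite lt_def v0 hnorm_ge0.
have := rip_ge0 ((hnorm ip v)%:C *: u - (hnorm ip u)%:C *: v).
rewrite ripBl !ripBr !ripZl !ripZr -!hnorm_sq (ripC v u).
set a := hnorm ip u; set b := hnorm ip v; set t := rip u v => h.
have [a0|a0] := eqVneq a 0.
  by rewrite a0 mul0r /t (hnorm_eq0 a0) /rip ip0l.
have ap : 0 < a by rewrite lt_def a0 hnorm_ge0.
have : 0 <= 2 * (a * b) * (a * b - t).
  by apply: le_trans h _; rewrite le_eqVlt; apply/orP; left; apply/eqP; ring.
by rewrite pmulr_rge0 ?subr_ge0 // !mulr_gt0.
Qed.

Lemma hnorm_triangle u v : hnorm ip (u + v) <= hnorm ip u + hnorm ip v.
Proof.
rewrite -(ler_pXn2r (n := 2)) ?nnegrE ?addr_ge0 ?hnorm_ge0 //.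
rewrite hnorm_sq ripDl !ripDr -!hnorm_sq (ripC v u).
have := cauchy_schwarz u v; nra.
Qed.

Lemma hnormZ r u : hnorm ip (r%:C *: u) = `|r| * hnorm ip u.
Proof.
apply/eqP; rewrite -(eqrXn2 (n := 2)) ?mulr_ge0 ?hnorm_ge0 //.
by rewrite hnorm_sq ripZl ripZr exprMn -hnorm_sq real_normK ?num_real //; apply/eqP; ring.
Qed.

Lemma hnorm_opp u : hnorm ip (- u) = hnorm ip u.
Proof. by rewrite -scaleN1r -(rmorphN1 (real_complex R)) hnormZ normrN1 mul1r. Qed.

Implicit Types (x y : H -> H).

Lemma bounded_opD x (hx : bounded_op ip x) u v : x (u + v) = x u + x v.
Proof. by have /= := hx.1 1 u v; rewrite !scale1r. Qed.

Lemma bounded_op0 x (hx : bounded_op ip x) : x 0 = 0.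
Proof.
have := bounded_opD hx 0 0; rewrite addr0 => /esym/eqP.
by rewrite -subr_eq0 addrK => /eqP.
Qed.

Lemma bounded_opZ x (hx : bounded_op ip x) c u : x (c *: u) = c *: x u.
Proof. by have := hx.1 c u 0; rewrite !addr0 (bounded_op0 hx) addr0. Qed.

Lemma opnorm_has_sup x : bounded_op ip x ->
  has_sup [set hnorm ip (x u) | u in [set u | hnorm ip u <= 1]].
Proof.
move=> hx; split; first by exists (hnorm ip (x 0)), 0 => //=; rewrite hnorm0.
case: hx => _ [K hK]; exists `|K| => _ [u /= hu <-].
apply: le_trans (hK u) _; apply: le_trans (ler_norm _) _.
by rewrite normrM ler_piMr // ger0_norm ?hnorm_ge0.
Qed.

Lemma opnorm_ge0 x : bounded_op ip x -> 0 <= opnorm ip x.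
Proof.
move=> hx; apply: le_trans (hnorm_ge0 (x 0)) _.
by apply: sup_ubound; [case: (opnorm_has_sup hx) | exists 0 => //=; rewrite hnorm0].
Qed.

Lemma hnorm_op x u : bounded_op ip x ->
  hnorm ip (x u) <= opnorm ip x * hnorm ip u.
Proof.
move=> hx; have [u0|u0] := eqVneq (hnorm ip u) 0.
  by rewrite (hnorm_eq0 u0) (bounded_op0 hx) hnorm0 mulr0.
have up : 0 < hnorm ip u by rewrite lt_def u0 hnorm_ge0.
rewrite -ler_pdivrMr //.
have -> : hnorm ip (x u) / hnorm ip u = hnorm ip (x (((hnorm ip u)^-1)%:C *: u)).
  by rewrite (bounded_opZ hx) hnormZ ger0_norm ?invr_ge0 ?hnorm_ge0 // mulrC.
apply: sup_ubound; first by case: (opnorm_has_sup hx).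
by exists (((hnorm ip u)^-1)%:C *: u) => //=; rewrite hnormZ ger0_norm ?invr_ge0 ?hnorm_ge0 // mulVf.
Qed.

Lemma opnorm_le x (K : R) : 0 <= K ->
  (forall u, hnorm ip (x u) <= K * hnorm ip u) -> opnorm ip x <= K.
Proof.
move=> K0 hK; apply: ge_sup; first by exists (hnorm ip (x 0)), 0 => //=; rewrite hnorm0.
by move=> _ [u /= hu <-]; apply: le_trans (hK u) _; rewrite ler_piMr.
Qed.

Lemma op_ge0P x : op_le ip 0 x <-> forall u, 0 <= ip (x u) u.
Proof. by split=> h u; have := h u; rewrite /= subr0. Qed.

Lemma adjoint_unique x y z : is_adjoint ip x y -> is_adjoint ip x z -> y = z.
Proof.
move=> hy hz; apply/funext => v; apply/eqP; rewrite -subr_eq0.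
apply/eqP/hnorm_eq0; apply/eqP; rewrite -sqrf_eq0 hnorm_sq /rip.
by rewrite ipBr -hy -hz subrr.
Qed.

Lemma adjE x y : is_adjoint ip x y -> adj ip x = y.
Proof. by move=> h; apply: (@adjoint_unique x) => //; exact: xgetI h. Qed.

Lemma selfadjoint_real x u : is_adjoint ip x x ->
  ip (x u) u = (rip (x u) u)%:C.
Proof.
move=> h; have := ipC (x u) u; rewrite -h /rip.
by case: (ip (x u) u) => a b [] /eqP; rewrite -subr_eq0 opprK -mulr2n mulrn_eq0 /= => /eqP ->.
Qed.

Lemma selfadjoint_ge0 x : is_adjoint ip x x ->
  (forall u, 0 <= rip (x u) u) -> op_le ip 0 x.
Proof.
by move=> hx h; apply/op_ge0P => u; rewrite selfadjoint_real // ler0c.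
Qed.

End HilbertSpace.

(** * The trace inequality behind Golden-Thompson *)

(** Only the *-ring structure and the positivity of the trace enter the
    inequality, so it is stated without reference to operators. *)
Record positive_trace (F : realFieldType) (T : pzRingType)
    (star : T -> T) (tr : T -> F) : Prop := {
  starK : involutive star;
  starB : {morph star : x y / x - y};
  starM : forall x y, star (x * y) = star y * star x;
  traceB : {morph tr : x y / x - y};
  traceC : forall x y, tr (x * y) = tr (y * x);
  trace_star : forall x, tr (star x) = tr x;
  trace_sq_ge0 : forall x, 0 <= tr (star x * x) }.

Section TraceInequality.
Context (F : realFieldType) (T : pzRingType) (star : T -> T) (tr : T -> F).
Hypothesis htr : positive_trace star tr.
Implicit Types (x y a b : T).

Lemma star1 : star 1 = 1.
Proof. by rewrite -[LHS]mul1r -{1}(starK htr 1) -(starM htr) mul1r (starK htr). Qed.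

Lemma starX x n : star (x ^+ n) = star x ^+ n.
Proof.
elim: n => [|n IH]; first by rewrite !expr0 star1.
by rewrite exprS (starM htr) IH exprSr.
Qed.

(** Polarised positivity. It replaces the Cauchy-Schwarz inequality, because in
    the two uses below both squares on the right have the same trace. *)
Lemma trace_mul_le x y : 2 * tr (star x * y) <= tr (star x * x) + tr (star y * y).
Proof.
have := trace_sq_ge0 htr (x - y).
rewrite (starB htr) mulrBl !mulrBr !(traceB htr).
have -> : tr (star y * x) = tr (star x * y).
  by rewrite -(trace_star htr) (starM htr) (starK htr).
lra.
Qed.

Lemma trace_sa_mul_le a b : star a = a -> star b = b -> tr (a * a) = tr (b * b) ->
  tr (a * b) <= tr (a * a).
Proof. by move=> ha hb hab; have := trace_mul_le a b; rewrite ha hb -hab; lra. Qed.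

Lemma trace_expC x y n : tr ((x * y) ^+ n) = tr ((y * x) ^+ n).
Proof.
case: n => [//|n].
have shift : (x * y) ^+ n * x = x * (y * x) ^+ n.
  elim: n => [|n IH]; first by rewrite !expr0 mul1r mulr1.
  by rewrite exprS -mulrA IH exprS !mulrA.
by rewrite exprSr mulrA shift -mulrA (traceC htr) -mulrA -exprSr.
Qed.

(** The two statements feed each other. For the first at level [k.+1], apply it
    at level [k] to [x * x]; the result is the trace of a power of a product of
    the self-adjoint elements [x^* x] and [x x^*], whose powers have equal
    traces. For the second at level [k.+1], apply the first to [a * b] and
    rotate [b a a b] into [a^2 b^2]. *)
Lemma trace_exp_pow2 k :
  (forall x, tr (x ^+ (2 ^ k.+1)) <= tr ((star x * x) ^+ (2 ^ k))) /\
  (forall a b, star a = a -> star b = b ->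
     tr ((a * b) ^+ (2 ^ k)) <= tr (a ^+ (2 ^ k) * b ^+ (2 ^ k))).
Proof.
elim: k => [|k [IHx IHab]]; split.
- move=> x; rewrite expr2 expr1.
  have := trace_mul_le (star x) x; rewrite (starK htr) (traceC htr x (star x)); lra.
- by move=> a b _ _; rewrite !expr1.
- move=> x; rewrite expnS exprM.
  apply: le_trans (IHx _) _.
  have -> : star (x ^+ 2) * x ^+ 2 = star x * (star x * x * x).
    by rewrite !expr2 (starM htr) !mulrA.
  rewrite trace_expC -[_ * x * star x]mulrA.
  have sa1 : star (star x * x) = star x * x by rewrite (starM htr) (starK htr).
  have sa2 : star (x * star x) = x * star x by rewrite (starM htr) (starK htr).
  apply: le_trans (IHab _ _ sa1 sa2) _.
  rewrite expnS mulnC exprM expr2.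
  apply: trace_sa_mul_le; rewrite ?starX ?sa1 ?sa2 //.
  by rewrite -!expr2 -!exprM trace_expC.
- move=> a b ha hb; rewrite {1}expnSr -expnSr.
  apply: le_trans (IHx _) _.
  rewrite (starM htr) ha hb mulrA -(mulrA b a a) -mulrA trace_expC.
  rewrite -mulrA -!expr2.
  have sa2 c : star c = c -> star (c ^+ 2) = c ^+ 2 by move=> hc; rewrite starX hc.
  apply: le_trans (IHab _ _ (sa2 a ha) (sa2 b hb)) _.
  by rewrite -!exprM -!expnS.
Qed.

End TraceInequality.

(** * Self-adjoint algebras of bounded operators as rings *)

(** Composition of arbitrary maps [H -> H] does not distribute over sums on the
    left, so the ring structure lives on the elements of a fixed algebra of
    linear maps. Nontriviality makes that ring a unital algebra over [R], in which
    real polynomials can be evaluated by [horner_alg]. *)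
Record op_algebra (R : realType) (H : lmodType R[i]) (ip : {dot H for Num.conj}) :=
  OpAlgebra {
  opa_set : set (H -> H);
  opa_unital : unital_subalgebra opa_set;
  opa_bounded : forall x, opa_set x -> bounded_op ip x;
  opa_adj : forall x, opa_set x -> exists2 y, opa_set y & is_adjoint ip x y;
  opa_nontrivial : idfun <> 0 :> (H -> H) }.

Section OpAlgebraRing.
Context (R : realType) (H : lmodType R[i]) (ip : {dot H for Num.conj}).
Context (S : op_algebra ip).

Record op_elt := OpElt { op_of :> H -> H; op_ofP : opa_set S op_of }.

Implicit Types (x y z : op_elt) (r : R) (u v : H).

Lemma op_elt_inj x y : (forall u, x u = y u) -> x = y.
Proof.
case: x y => [x hx] [y hy] /= /funext exy; subst y.
by congr OpElt; exact: Prop_irrelevance.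
Qed.

HB.instance Definition _ := gen_eqMixin op_elt.
HB.instance Definition _ := gen_choiceMixin op_elt.

Lemma elt_bounded x : bounded_op ip x.
Proof. exact/opa_bounded/op_ofP. Qed.

Lemma opa_lin (c : R[i]) (x y : H -> H) :
  opa_set S x -> opa_set S y -> opa_set S (c *: x + y).
Proof. by case: (opa_unital S) => _ h _; exact: h. Qed.

Lemma opa_one : opa_set S idfun.
Proof. by case: (opa_unital S). Qed.

Lemma opa_comp (x y : H -> H) : opa_set S x -> opa_set S y -> opa_set S (x \o y).
Proof. by case: (opa_unital S) => _ _ h; exact: h. Qed.

Lemma opa_zero : opa_set S 0.
Proof. by have := opa_lin (-1) opa_one opa_one; rewrite scaleN1r addNr. Qed.

Lemma opa_scale c (x : H -> H) : opa_set S x -> opa_set S (c *: x).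
Proof. by move=> hx; have := opa_lin c hx opa_zero; rewrite addr0. Qed.

Lemma opa_add (x y : H -> H) : opa_set S x -> opa_set S y -> opa_set S (x + y).
Proof. by move=> hx hy; have := opa_lin 1 hx hy; rewrite scale1r. Qed.

Lemma opa_opp (x : H -> H) : opa_set S x -> opa_set S (- x).
Proof. by move=> hx; rewrite -scaleN1r; exact: opa_scale. Qed.

Definition elt_zero := OpElt opa_zero.
Definition elt_one := OpElt opa_one.
Definition elt_add x y := OpElt (opa_add (op_ofP x) (op_ofP y)).
Definition elt_opp x := OpElt (opa_opp (op_ofP x)).
Definition elt_mul x y := OpElt (opa_comp (op_ofP x) (op_ofP y)).
Definition elt_scale (r : R) x := OpElt (opa_scale r%:C (op_ofP x)).

Fact elt_addA : associative elt_add.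
Proof. by move=> x y z; apply: op_elt_inj => u; exact: addrA. Qed.
Fact elt_addC : commutative elt_add.
Proof. by move=> x y; apply: op_elt_inj => u; exact: addrC. Qed.
Fact elt_add0 : left_id elt_zero elt_add.
Proof. by move=> x; apply: op_elt_inj => u; exact: add0r. Qed.
Fact elt_addN : left_inverse elt_zero elt_opp elt_add.
Proof. by move=> x; apply: op_elt_inj => u; exact: addNr. Qed.
HB.instance Definition _ := GRing.isZmodule.Build op_elt
  elt_addA elt_addC elt_add0 elt_addN.

Fact elt_mulA : associative elt_mul.
Proof. by move=> x y z; apply: op_elt_inj. Qed.
Fact elt_mul1 : left_id elt_one elt_mul.
Proof. by move=> x; apply: op_elt_inj. Qed.
Fact elt_mulr1 : right_id elt_one elt_mul.
Proof. by move=> x; apply: op_elt_inj. Qed.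
Fact elt_mulDl : left_distributive elt_mul +%R.
Proof. by move=> x y z; apply: op_elt_inj. Qed.
Fact elt_mulDr : right_distributive elt_mul +%R.
Proof. by move=> x y z; apply: op_elt_inj => u; exact/bounded_opD/elt_bounded. Qed.
Fact elt_one_neq0 : elt_one != 0.
Proof. by apply/eqP => h; apply: (opa_nontrivial S); exact: (f_equal op_of h). Qed.
HB.instance Definition _ := GRing.Zmodule_isNzRing.Build op_elt
  elt_mulA elt_mul1 elt_mulr1 elt_mulDl elt_mulDr elt_one_neq0.

Fact elt_scaleA r s x : elt_scale r (elt_scale s x) = elt_scale (r * s) x.
Proof. by apply: op_elt_inj => u; rewrite /= /GRing.scale /= rmorphM scalerA. Qed.
Fact elt_scale1 : left_id 1 elt_scale.
Proof. by move=> x; apply: op_elt_inj => u; exact: scale1r. Qed.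
Fact elt_scaleDr : right_distributive elt_scale +%R.
Proof. by move=> r x y; apply: op_elt_inj => u; exact: scalerDr. Qed.
Fact elt_scaleDl x : {morph elt_scale^~ x : r s / r + s}.
Proof. by move=> r s; apply: op_elt_inj => u; rewrite /= rmorphD; exact: scalerDl. Qed.
HB.instance Definition _ := GRing.Zmodule_isLmodule.Build R op_elt
  elt_scaleA elt_scale1 elt_scaleDr elt_scaleDl.

Fact elt_scaleAl (r : R) x y : r *: (x * y) = (r *: x) * y.
Proof. by apply: op_elt_inj. Qed.
HB.instance Definition _ := GRing.Lmodule_isLalgebra.Build R op_elt elt_scaleAl.

Fact elt_scaleAr (r : R) x y : r *: (x * y) = x * (r *: y).
Proof. by apply: op_elt_inj => u; exact/esym/bounded_opZ/elt_bounded. Qed.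
HB.instance Definition _ := GRing.Lalgebra_isAlgebra.Build R op_elt elt_scaleAr.

Lemma eltDE x y u : (x + y) u = x u + y u. Proof. by []. Qed.
Lemma eltBE x y u : (x - y) u = x u - y u. Proof. by []. Qed.
Lemma eltME x y u : (x * y) u = x (y u). Proof. by []. Qed.
Lemma eltZE r x u : (r *: x) u = r%:C *: x u. Proof. by []. Qed.
Lemma elt1E u : (1 : op_elt) u = u. Proof. by []. Qed.

Lemma elt_adjoint_exists x : exists y : op_elt, is_adjoint ip x y.
Proof. by have [y hy hxy] := opa_adj (op_ofP x); exists (OpElt hy). Qed.

Definition elt_star x : op_elt := projT1 (cid (elt_adjoint_exists x)).

Lemma elt_starP x : is_adjoint ip x (elt_star x).
Proof. exact: (projT2 (cid (elt_adjoint_exists x))). Qed.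

Lemma elt_star_unique x y : is_adjoint ip x y -> elt_star x = y.
Proof.
move=> h; have e := adjoint_unique (elt_starP x) h.
by apply: op_elt_inj => u; rewrite e.
Qed.

Lemma elt_starK : involutive elt_star.
Proof.
move=> x; apply: elt_star_unique => u v.
by rewrite ipC -(elt_starP x) -ipC.
Qed.

Lemma elt_starZD r x y : elt_star (r *: x + y) = r *: elt_star x + elt_star y.
Proof.
apply: elt_star_unique => u v.
rewrite !eltDE !eltZE ipDl ipDr ipZl ipZr (elt_starP x) (elt_starP y).
by congr (_ * _ + _); exact/esym/conjc_real.
Qed.

Lemma elt_starB : {morph elt_star : x y / x - y}.
Proof. by move=> x y; rewrite addrC -scaleN1r elt_starZD scaleN1r addrC. Qed.

Lemma elt_star_mul x y : elt_star (x * y) = elt_star y * elt_star x.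
Proof.
by apply: elt_star_unique => u v; rewrite !eltME (elt_starP x) (elt_starP y).
Qed.

Definition nneg x : Prop := op_le ip 0 x.

Definition selfadjoint x : Prop := elt_star x = x.

Lemma sa_adjoint x : selfadjoint x -> is_adjoint ip x x.
Proof. by move=> hx; have := elt_starP x; rewrite hx. Qed.

Lemma saZD r x y : selfadjoint x -> selfadjoint y -> selfadjoint (r *: x + y).
Proof. by move=> hx hy; rewrite /selfadjoint elt_starZD hx hy. Qed.

Lemma sa1 : selfadjoint 1.
Proof. by apply: elt_star_unique => u v. Qed.

Lemma sa0 : selfadjoint 0.
Proof. by apply: elt_star_unique => u v; rewrite linear0l linear0r. Qed.

Lemma saD x y : selfadjoint x -> selfadjoint y -> selfadjoint (x + y).
Proof. by move=> hx hy; rewrite -[x]scale1r; exact: saZD. Qed.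

Lemma saZ r x : selfadjoint x -> selfadjoint (r *: x).
Proof. by move=> hx; rewrite -[r *: x]addr0; apply: saZD sa0. Qed.

Lemma saB x y : selfadjoint x -> selfadjoint y -> selfadjoint (x - y).
Proof. by move=> hx hy; rewrite /selfadjoint elt_starB hx hy. Qed.

Lemma sa_comm_mul x y : selfadjoint x -> selfadjoint y -> GRing.comm x y -> selfadjoint (x * y).
Proof. by move=> hx hy hxy; rewrite /selfadjoint elt_star_mul hx hy hxy. Qed.

Lemma saX x n : selfadjoint x -> selfadjoint (x ^+ n).
Proof.
move=> hx; elim: n => [|n IH]; first exact: sa1.
by rewrite exprS; apply: sa_comm_mul => //; exact/commrX.
Qed.

Lemma nneg_rip x : nneg x -> forall u, 0 <= rip ip (x u) u.
Proof. by move=> /op_ge0P h u; have := h u; rewrite lecE => /andP[]. Qed.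

Lemma sa_nneg x : selfadjoint x -> (forall u, 0 <= rip ip (x u) u) -> nneg x.
Proof. by move=> /sa_adjoint; exact: selfadjoint_ge0. Qed.

Lemma nnegD x y : nneg x -> nneg y -> nneg (x + y).
Proof.
move=> /op_ge0P hx /op_ge0P hy; apply/op_ge0P => u.
by rewrite eltDE ipDl addr_ge0.
Qed.

Lemma nnegZ r x : 0 <= r -> nneg x -> nneg (r *: x).
Proof.
move=> r0 /op_ge0P hx; apply/op_ge0P => u.
by rewrite eltZE ipZl mulr_ge0 // ler0c.
Qed.

Lemma nneg_conj x y : nneg x -> nneg (elt_star y * x * y).
Proof.
move=> /op_ge0P hx; apply/op_ge0P => u.
by rewrite !eltME (elt_starP (elt_star y)) elt_starK.
Qed.

Lemma nneg1 : nneg 1.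
Proof. by apply/op_ge0P => u; exact: ip_ge0. Qed.

Lemma nneg_sq x : nneg (elt_star x * x).
Proof. by rewrite -[elt_star x]mulr1; exact/nneg_conj/nneg1. Qed.

Lemma nneg_exp_even x n : selfadjoint x -> ~~ odd n -> nneg (x ^+ n).
Proof.
move=> hx /even_halfK <-; rewrite -addnn exprD -{1}(saX n./2 hx).
exact: nneg_sq.
Qed.

Definition nrm x : R := opnorm ip x.

Lemma nrm_ge0 x : 0 <= nrm x.
Proof. exact/opnorm_ge0/elt_bounded. Qed.

Lemma hnorm_nrm x u : hnorm ip (x u) <= nrm x * hnorm ip u.
Proof. exact/hnorm_op/elt_bounded. Qed.

Lemma nrmD x y : nrm (x + y) <= nrm x + nrm y.
Proof.
apply: opnorm_le; first by rewrite addr_ge0 // nrm_ge0.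
move=> u; rewrite eltDE mulrDl; apply: le_trans (hnorm_triangle _ _ _) _.
by apply: lerD; exact: hnorm_nrm.
Qed.

Lemma nrmM x y : nrm (x * y) <= nrm x * nrm y.
Proof.
apply: opnorm_le; first by rewrite mulr_ge0 // nrm_ge0.
move=> u; rewrite eltME -mulrA; apply: le_trans (hnorm_nrm _ _) _.
by rewrite ler_wpM2l ?nrm_ge0 // hnorm_nrm.
Qed.

Lemma nrmZ_le r x : nrm (r *: x) <= `|r| * nrm x.
Proof.
apply: opnorm_le; first by rewrite mulr_ge0 // nrm_ge0.
by move=> u; rewrite eltZE hnormZ -mulrA ler_wpM2l // hnorm_nrm.
Qed.

Lemma nrm1 : nrm 1 <= 1.
Proof. by apply: opnorm_le => // u; rewrite mul1r. Qed.

Lemma nrmX x n : nrm (x ^+ n) <= nrm x ^+ n.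
Proof.
elim: n => [|n IH]; first by rewrite !expr0 nrm1.
by rewrite !exprS; apply: le_trans (nrmM _ _) _; rewrite ler_wpM2l ?nrm_ge0.
Qed.

Lemma rip_nrm x u : `|rip ip (x u) u| <= nrm x * rip ip u u.
Proof.
have h : forall v, hnorm ip v <= nrm x * hnorm ip u -> rip ip v u <= nrm x * rip ip u u.
  move=> v hv; apply: le_trans (cauchy_schwarz _ _ _) _.
  by rewrite -hnorm_sq expr2 mulrA ler_wpM2r ?hnorm_ge0.
rewrite ler_norml h ?hnorm_nrm // andbT lerNl.
have := h (- x u); rewrite hnorm_opp => /(_ (hnorm_nrm _ _)).
by rewrite /rip linearNl /= ReN.
Qed.

Lemma nneg_nrm x : selfadjoint x -> nneg (nrm x *: 1 - x).
Proof.
move=> hx; apply: sa_nneg; first by apply: saB => //; exact/saZ/sa1.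
move=> u; rewrite eltBE eltZE elt1E ripBl ripZl subr_ge0.
exact: le_trans (ler_norm _) (rip_nrm _ _).
Qed.

Lemma nrm_sq x : selfadjoint x -> nrm x ^+ 2 <= nrm (x ^+ 2).
Proof.
move=> hx; have h0 := nrm_ge0 (x ^+ 2).
rewrite -(sqr_sqrtr h0) ler_pXn2r ?nnegrE ?nrm_ge0 ?sqrtr_ge0 //.
apply: opnorm_le; first exact: sqrtr_ge0.
move=> u; rewrite -(ler_pXn2r (n := 2)) ?nnegrE ?mulr_ge0 ?hnorm_ge0 ?sqrtr_ge0 //.
rewrite exprMn !hnorm_sq sqr_sqrtr //.
have -> : rip ip (x u) (x u) = rip ip ((x ^+ 2) u) u.
  by rewrite expr2 eltME /rip [in RHS](sa_adjoint hx).
exact: le_trans (ler_norm _) (rip_nrm _ _).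
Qed.

End OpAlgebraRing.

(** * Polynomials that are positive on an interval *)

(** The preordering generated by the endpoint factors [c - X] and [c + X]. *)
Inductive interval_cone (R : realType) (c : R) : {poly R} -> Prop :=
| cone_sq s : interval_cone c (s ^+ 2)
| cone_left s : interval_cone c ((c%:P - 'X) * s ^+ 2)
| cone_right s : interval_cone c ((c%:P + 'X) * s ^+ 2)
| cone_both s : interval_cone c ((c%:P - 'X) * (c%:P + 'X) * s ^+ 2)
| cone_add p q : interval_cone c p -> interval_cone c q -> interval_cone c (p + q).

Section IntervalCone.
Context (R : realType) (c : R).
Implicit Types (p q r s : {poly R}).

Lemma cone_mul_sq q r : interval_cone c r -> interval_cone c (q ^+ 2 * r).
Proof.
elim=> [s|s|s|s|p p' _ h _ h'].
- by rewrite -exprMn; exact: cone_sq.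
- by rewrite mulrCA -exprMn; exact: cone_left.
- by rewrite mulrCA -exprMn; exact: cone_right.
- by rewrite mulrCA -exprMn; exact: cone_both.
- by rewrite mulrDr; exact: cone_add.
Qed.

Lemma cone_scale (a : R) r : 0 <= a -> interval_cone c r -> interval_cone c (a%:P * r).
Proof. by move=> a0 hr; rewrite -(sqr_sqrtr a0) rmorphXn; exact: cone_mul_sq. Qed.

Lemma cone_mul_left r : interval_cone c r -> interval_cone c ((c%:P - 'X) * r).
Proof.
elim=> [s|s|s|s|p p' _ h _ h'].
- exact: cone_left.
- have -> : (c%:P - 'X) * ((c%:P - 'X) * s ^+ 2) = ((c%:P - 'X) * s) ^+ 2 by ring.
  exact: cone_sq.
- by rewrite mulrA; exact: cone_both.
- have -> : (c%:P - 'X) * ((c%:P - 'X) * (c%:P + 'X) * s ^+ 2) =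
    (c%:P + 'X) * ((c%:P - 'X) * s) ^+ 2 by ring.
  exact: cone_right.
- by rewrite mulrDr; exact: cone_add.
Qed.

Lemma cone_mul_right r : interval_cone c r -> interval_cone c ((c%:P + 'X) * r).
Proof.
elim=> [s|s|s|s|p p' _ h _ h'].
- exact: cone_right.
- by rewrite mulrA (mulrC (c%:P + 'X)); exact: cone_both.
- have -> : (c%:P + 'X) * ((c%:P + 'X) * s ^+ 2) = ((c%:P + 'X) * s) ^+ 2 by ring.
  exact: cone_sq.
- have -> : (c%:P + 'X) * ((c%:P - 'X) * (c%:P + 'X) * s ^+ 2) =
    (c%:P - 'X) * ((c%:P + 'X) * s) ^+ 2 by ring.
  exact: cone_left.
- by rewrite mulrDr; exact: cone_add.
Qed.

(** The divisor is the minimal polynomial of [a + b i] over the reals: a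
    remainder of degree at most 1 with a non-real root vanishes. *)
Lemma nonreal_root_dvd r (a b : R) : b != 0 ->
  root (map_poly (real_complex R) r) (a +i* b) ->
  ('X - a%:P) ^+ 2 + (b ^+ 2)%:P %| r.
Proof.
move=> b0 rz; set d := (X in X %| r).
have sd : size d = 3%N.
  rewrite /d size_polyDl size_exp_XsubC // size_polyC.
  by case: eqP.
have dz : (map_poly (real_complex R) d).[a +i* b] = 0.
  rewrite /d rmorphD rmorphXn rmorphB /= map_polyX !map_polyC /= !hornerE !expr2.
  by apply/eqP; rewrite eq_complex /=; apply/andP; split; apply/eqP; ring.
set m := r %% d.
have sm : (size m <= 2)%N by rewrite -ltnS -sd ltn_modp -size_poly_gt0 sd.
have mz : (map_poly (real_complex R) m).[a +i* b] = 0.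
  move: rz; rewrite /root {1}(divp_eq r d) rmorphD rmorphM hornerD hornerM dz.
  by rewrite mulr0 add0r => /eqP.
have em : m = m`_1 *: 'X + (m`_0)%:P.
  apply/polyP => -[|[|k]]; rewrite !coefE ?mulr0 ?mulr1 ?add0r ?addr0 //.
  by rewrite nth_default // (leq_trans sm).
move: mz; rewrite em rmorphD /= map_polyZ map_polyX map_polyC /= hornerD hornerZ.
rewrite hornerX hornerC => /eqP; rewrite eq_complex /= => /andP[/eqP h0 /eqP h1].
have m1 : m`_1 = 0.
  have : m`_1 * b = 0 by apply: etrans _ h1; ring.
  by move/eqP; rewrite mulf_eq0 (negPf b0) orbF => /eqP.
have m0 : m`_0 = 0 by apply: etrans _ h0; rewrite m1; ring.
by rewrite /dvdp -/m em m1 m0 scale0r add0r polyC0.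
Qed.

(** Strict positivity keeps the real roots off the interval, so every root of
    the polynomial splits off a factor which preserves the cone: a linear factor
    of constant sign on the interval, or a sum of two squares. *)
Lemma pos_interval_cone r : 0 <= c -> (forall t, `|t| <= c -> 0 < r.[t]) ->
  interval_cone c r.
Proof.
move=> c0; have [n] := ubnP (size r); elim: n r => // n IH r.
rewrite ltnS => sr hr.
have [s1|s1] := leqP (size r) 1.
  have r0 : 0 < r.[0] by apply: hr; rewrite normr0.
  move: r0; rewrite (size1_polyC s1) hornerC => r0.
  by rewrite -(mulr1 _%:P) -(expr1n _ 2); apply: cone_scale (ltW r0) (cone_sq _ _).
have r0 : r != 0 by rewrite -size_poly_gt0 (leq_trans _ s1).
have qsize q d : r = q * d -> (1 < size d)%N -> (size q < n)%N.
  move=> e sd; apply: leq_trans sr; rewrite e size_mul.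
  - by rewrite -subn1 ltn_subRL addnC ltn_add2l.
  - by apply: contraNneq r0 => q0; rewrite e q0 mul0r.
  - by apply: contraNneq r0 => d0; rewrite e d0 mulr0.
have [z rz] : exists z, root (map_poly (real_complex R) r) z.
  by apply/closed_rootP; rewrite size_map_poly; case: (size r) s1 => [|[]].
case: z rz => a b rz.
have [b0|b0] := eqVneq b 0; last first.
  have /dvdpP[q e] := nonreal_root_dvd b0 rz.
  have qc : interval_cone c q.
    apply: IH.
      apply: qsize e _.
      by rewrite size_polyDl size_exp_XsubC // size_polyC; case: eqP.
    move=> t ht; have := hr t ht; rewrite e !hornerE; rewrite pmulr_lgt0 //.
    by rewrite ltr_wpDl ?sqr_ge0 // lt_def sqr_ge0 sqrf_eq0 b0.
  rewrite e mulrDr mulrC (mulrC q) ; apply: cone_add; first exact: cone_mul_sq.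
  by apply: cone_scale => //; exact: sqr_ge0.
have ra : root r a.
  by move: rz; rewrite b0 complexr0 /root horner_map /= fmorph_eq0.
have /factor_theorem[q e] := ra.
have sq : (size q < n)%N by apply: qsize e _; rewrite size_XsubC.
have [ac|ac] := lerP `|a| c.
  by have := hr a ac; rewrite (rootP ra) ltxx.
move: ac; rewrite lter_normr => /orP[ca|ac].
- have qc : interval_cone c (- q).
    apply: IH; first by rewrite size_polyN.
    move=> t /(fun h => conj (hr t h) (le_trans (ler_norm t) h))[].
    by rewrite e !hornerE => h tc; nra.
  have -> : r = (c%:P - 'X) * - q + (a - c)%:P * - q by rewrite e polyCB; ring.
  by apply: cone_add; [exact: cone_mul_left | apply: cone_scale => //; lra].
- have qc : interval_cone c q.
    apply: IH => // t /[dup] /hr; rewrite e !hornerE ler_norml => h /andP[ht _].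
    by nra.
  have -> : r = (c%:P + 'X) * q + (- a - c)%:P * q by rewrite e polyCB polyCN; ring.
  by apply: cone_add; [exact: cone_mul_right | apply: cone_scale => //; lra].
Qed.

End IntervalCone.

Section PolynomialCalculus.
Context (R : realType) (H : lmodType R[i]) (ip : {dot H for Num.conj}).
Context (S : op_algebra ip).
Implicit Types (x y : op_elt S) (p q : {poly R}).

Lemma poly_comm y p q : GRing.comm (horner_alg y p) (horner_alg y q).
Proof. by rewrite /GRing.comm -!rmorphM mulrC. Qed.

Lemma sa_poly y p : selfadjoint y -> selfadjoint (horner_alg y p).
Proof.
move=> hy; elim/poly_ind: p => [|p a IH]; first by rewrite rmorph0; exact: sa0.
rewrite rmorphD rmorphM /= horner_algX horner_algC.
apply: saD; last exact/saZ/sa1.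
by apply: sa_comm_mul => //; have := poly_comm y p 'X; rewrite horner_algX.
Qed.

Lemma cone_nneg y p : selfadjoint y -> interval_cone (nrm y) p -> nneg (horner_alg y p).
Proof.
move=> hy.
have conj w s : nneg (horner_alg y w) -> nneg (horner_alg y (w * s ^+ 2)).
  move=> hw; rewrite expr2 mulrCA !rmorphM /= mulrA.
  by rewrite -{1}(sa_poly s hy); exact: nneg_conj.
elim=> [s|s|s|s|r r' _ h _ h'].
- by rewrite -[s ^+ 2]mul1r; apply: conj; rewrite rmorph1; exact: nneg1.
- by apply: conj; rewrite rmorphB /= horner_algX horner_algC; exact: nneg_nrm.
- apply: conj; rewrite rmorphD /= horner_algX horner_algC.
  apply: sa_nneg; first by apply: saD => //; exact/saZ/sa1.
  move=> u; rewrite eltDE eltZE elt1E ripDl ripZl.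
  have /ler_normlP[h _] := rip_nrm y u; lra.
- apply: conj; rewrite -subr_sqr rmorphB !rmorphXn /= horner_algX horner_algC.
  apply: sa_nneg; first by apply: saB; apply: saX => //; exact/saZ/sa1.
  move=> u; rewrite eltBE !expr2 !eltME !eltZE !elt1E ripBl !ripZl.
  rewrite subr_ge0 {1}/rip (sa_adjoint hy) -/(rip _ _ _) -!hnorm_sq mulrA -expr2.
  by rewrite -exprMn ler_pXn2r ?nnegrE ?mulr_ge0 ?hnorm_ge0 ?nrm_ge0 ?hnorm_nrm.
- by rewrite rmorphD; exact: nnegD.
Qed.

(** The part of the spectral theorem that is used: the polynomial functional
    calculus of a self-adjoint operator is positive on [-|y|, |y|]. *)
Lemma poly_nneg y p : selfadjoint y -> (forall t, `|t| <= nrm y -> 0 <= p.[t]) ->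
  nneg (horner_alg y p).
Proof.
move=> hy hp; apply: sa_nneg; first exact: sa_poly.
move=> u; apply/ler_addgt0Pr => e e0.
have u0 := rip_ge0 ip u.
have := @cone_nneg y (p + (e / (1 + rip ip u u))%:P) hy.
have /[swap]/[apply] : interval_cone (nrm y) (p + (e / (1 + rip ip u u))%:P).
  apply: pos_interval_cone; first exact: nrm_ge0.
  move=> t ht; rewrite hornerD hornerC ltr_wpDl ?hp //.
  by rewrite divr_gt0 // ltr_wpDr.
rewrite rmorphD /= horner_algC => /nneg_rip/(_ u).
rewrite eltDE eltZE elt1E ripDl ripZl.
move=> h; apply: le_trans h _; rewrite lerD2l mulrAC ler_pdivrMr ?ltr_wpDr //.
by rewrite ler_pM2l // lerDr.
Qed.

Lemma poly_nrm_le y p (K : R) : selfadjoint y -> 0 <= K ->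
  (forall t, `|t| <= nrm y -> `|p.[t]| <= K) -> nrm (horner_alg y p) <= K.
Proof.
move=> hy K0 hp; apply: opnorm_le => // u.
have : nneg (horner_alg y ((K ^+ 2)%:P - p ^+ 2)).
  apply: poly_nneg => // t ht; rewrite !hornerE subr_ge0 -[leLHS]real_normK ?num_real //.
  by rewrite ler_pXn2r ?nnegrE ?hp.
rewrite rmorphB /= horner_algC (rmorphXn (horner_alg y)) => /nneg_rip/(_ u).
rewrite eltBE eltZE elt1E (expr2 (horner_alg y p)) eltME ripBl ripZl subr_ge0 {1}/rip (sa_adjoint (sa_poly p hy)).
rewrite -/(rip _ _ _) -!hnorm_sq -exprMn.
by rewrite ler_pXn2r ?nnegrE ?mulr_ge0 ?hnorm_ge0.
Qed.

End PolynomialCalculus.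

(** * Discrete exponentials in a tracial algebra *)

Lemma even_pow2 j : (0 < j)%N -> ~~ odd (2 ^ j).
Proof. by case: j => // j _; rewrite oddX. Qed.

Section ScalarBounds.
Context (R : realType).
Implicit Types (t : R).

Lemma dexp_le_expR t N : (0 < N)%N -> 0 <= 1 + N%:R^-1 * t ->
  (1 + N%:R^-1 * t) ^+ N <= expR t.
Proof.
move=> N0 h; have {2}-> : t = N%:R * (N%:R^-1 * t).
  by rewrite mulrA mulfV ?mul1r // pnatr_eq0 -lt0n.
by rewrite expRM_natl lerXn2r ?nnegrE ?expR_ge0 ?expR_ge1Dx.
Qed.

(** From [exp (- t) >= 1 - t]: the right-hand side is at least [1 / (1 - t)]. *)
Lemma expR_le_quadratic t : t <= 2^-1 -> expR t <= 1 + t + 2 * t ^+ 2.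
Proof.
move=> t2; have h := expR_ge1Dx (- t).
have e : expR t * expR (- t) = 1 by exact: expRxMexpNx_1.
have t1 : 0 < 1 - t by lra.
rewrite -(ler_pM2r t1); apply: (@le_trans _ _ 1).
  by rewrite -[leRHS]e ler_pM2l ?expR_gt0.
have : 0 <= t ^+ 2 * (1 - 2 * t) by rewrite mulr_ge0 ?sqr_ge0 //; lra.
by rewrite !expr2; nra.
Qed.

Lemma dexp_le_quadratic t N : (0 < N)%N -> `|t| <= 2^-1 ->
  (1 + N%:R^-1 * t) ^+ N <= 1 + t + 2 * t ^+ 2.
Proof.
move=> N0; rewrite ler_norml => /andP[t1 t2].
apply: le_trans (expR_le_quadratic t2); apply: dexp_le_expR => //.
have NV1 : (N%:R : R)^-1 <= 1 by rewrite invf_le1 ?ler1n ?ltr0n.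
have NV : 0 < (N%:R : R)^-1 by rewrite invr_gt0 ltr0n.
nra.
Qed.

Lemma bernoulli_ge t n : 0 <= t -> 1 + n%:R * t <= (1 + t) ^+ n.
Proof.
move=> t0; elim: n => [|n IH]; first by rewrite expr0 mul0r addr0.
rewrite exprS -natr1; have n0 : 0 <= (n%:R : R) by [].
apply: le_trans (_ : (1 + t) * (1 + n%:R * t) <= _); first by nra.
by rewrite ler_wpM2l // addr_ge0.
Qed.

(** Since [q = 2 ^ j] divides [N = 2 ^ (j + i)], Bernoulli's inequality gives
    [(1 + t / N) ^ N >= (1 + t / q) ^ q >= (t / q) ^ q] for [t >= 0]. Both powers
    are even, so that the two signs of [t] together cover the line. *)
Lemma monomial_le_dexp t j i : (0 < j)%N ->
  ((2 ^ j)%:R^-1 * t) ^+ (2 ^ j) <=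
  (1 + (2 ^ (j + i))%:R^-1 * t) ^+ (2 ^ (j + i)) +
  (1 - (2 ^ (j + i))%:R^-1 * t) ^+ (2 ^ (j + i)).
Proof.
move=> j0.
have main (s : R) : 0 <= s -> ((2 ^ j)%:R^-1 * s) ^+ (2 ^ j) <=
    (1 + (2 ^ (j + i))%:R^-1 * s) ^+ (2 ^ (j + i)).
  move=> s0; rewrite [in leRHS]expnD (mulnC (2 ^ j)%N) [leRHS]exprM.
  have u0 : 0 <= (2 ^ (j + i))%:R^-1 * s by rewrite mulr_ge0 // invr_ge0.
  have v0 : 0 <= (2 ^ j)%:R^-1 * s by rewrite mulr_ge0 // invr_ge0.
  rewrite expnD (mulnC (2 ^ j)%N) in u0 *.
  rewrite lerXn2r ?nnegrE ?exprn_ge0 ?addr_ge0 //.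
  apply: le_trans (bernoulli_ge (2 ^ i) u0).
  rewrite natrM invfM !mulrA mulfV ?pnatr_eq0 ?expn_eq0 // mul1r.
  by rewrite lerDr.
have [t0|t0] := lerP 0 t.
  by apply: le_trans (main _ t0) _; rewrite lerDl exprn_even_ge0 ?even_pow2 ?addn_gt0 ?j0.
have -> : ((2 ^ j)%:R^-1 * t) ^+ (2 ^ j) = ((2 ^ j)%:R^-1 * - t) ^+ (2 ^ j).
  by rewrite mulrN exprNn -signr_odd (negPf (even_pow2 j0)) mul1r.
rewrite -mulrN; apply: le_trans (main (- t) _) _; first by rewrite oppr_ge0 ltW.
by rewrite lerDr exprn_even_ge0 ?even_pow2 ?addn_gt0 ?j0.
Qed.

(** With [s = |t| / K], the power [s^p] is at most [1] if [s <= 1], and at most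
    [s^Q] otherwise. *)
Lemma powR_le_moment (p K t : R) Q : 0 < p -> p <= Q%:R -> 0 < K -> ~~ odd Q ->
  `|t| `^ p <= K `^ p * (1 + K^-1 ^+ Q * t ^+ Q).
Proof.
move=> p0 pQ K0 evQ; pose s := `|t| / K.
have s0 : 0 <= s by rewrite divr_ge0 // ltW.
have -> : `|t| = K * s by rewrite mulrC divfK // gt_eqF.
rewrite powRM ?(ltW K0) // ler_wpM2l ?powR_ge0 //.
have -> : K^-1 ^+ Q * t ^+ Q = s ^+ Q.
  have -> : t ^+ Q = `|t| ^+ Q.
    by rewrite -normrX ger0_norm // exprn_even_ge0.
  by rewrite -exprMn mulrC.
have [s1|s1] := lerP s 1.
  apply: (@le_trans _ _ 1); last by rewrite lerDl exprn_ge0.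
  have -> : 1 = 1 `^ p :> R by rewrite powR1.
  by rewrite ge0_ler_powR ?nnegrE ?(ltW p0).
apply: (@le_trans _ _ (s `^ Q%:R)); first by rewrite ler_powR // ltW.
by rewrite powR_mulrn // lerDr.
Qed.

Lemma pow2_between (p : R) : 2 <= p -> exists2 j, (0 < j)%N & p <= (2 ^ j)%:R <= 2 * p.
Proof.
move=> p2; have ex : exists j, p <= (2 ^ j)%:R.
  exists (Num.bound p); apply: le_trans (ltW (archi_boundP _)) _; first lra.
  by rewrite ler_nat ltnW // ltn_expl.
case: (ex_minnP ex) => -[|j] hj hmin.
  by move: hj; rewrite expn0; lra.
exists j.+1 => //; rewrite hj /= expnS natrM ler_pM2l //.
rewrite leNgt; apply/negP => /ltW /hmin; by rewrite ltnn.
Qed.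

Lemma expR_bound (p : R) : 2 <= p -> 1 + 2 * expR (p / 2) <= expR (2 * p).
Proof.
move=> p2; have -> : 2 * p = 4%:R * (p / 2) by field.
rewrite expRM_natl; set z := expR _.
have z2 : 2 <= z by apply: le_trans (expR_ge1Dx _); lra.
have z4 : 4 <= z ^+ 2 by rewrite expr2; nra.
have -> : z ^+ 4 = z ^+ 2 * z ^+ 2 by rewrite -exprD.
have : z ^+ 2 * 4 <= z ^+ 2 * z ^+ 2 by rewrite ler_wpM2l // sqr_ge0.
have -> : z ^+ 2 = z * z by []; nra.
Qed.

End ScalarBounds.

(** Euler's approximation of the exponential. Unlike the exponential it is a
    polynomial, so it stays in every algebra that contains its argument. *)
Definition dexp (R : realType) (T : algType R) N (x : T) : T :=
  (1 + N%:R^-1 *: x) ^+ N.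

Section TraceMoments.
Context (R : realType) (H : lmodType R[i]) (ip : {dot H for Num.conj}).
Context (S : op_algebra ip).
Implicit Types (x y a b c : op_elt S) (p q : {poly R}) (r : R).

(** These functionals are real: they stand for the real part of a tracial state,
    which has the same values on self-adjoint elements. *)
Record tracial_state (tr : op_elt S -> R) : Prop := {
  tr_linear : forall r x y, tr (r *: x + y) = r * tr x + tr y;
  tr_mulC : forall x y, tr (x * y) = tr (y * x);
  tr_elt_star : forall x, tr (elt_star x) = tr x;
  tr_nneg : forall x, nneg x -> 0 <= tr x;
  tr_one : tr 1 = 1 }.

(** Coefficients of the form [E x] in the module property keep the range of [E]
    implicit. *)
Record expectation (tr : op_elt S -> R) (E : op_elt S -> op_elt S) : Prop := {
  exp_linear : forall r x y, E (r *: x + y) = r *: E x + E y;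
  exp_one : E 1 = 1;
  exp_nneg : forall x, nneg x -> nneg (E x);
  exp_module : forall x y, E (E x * y) = E x * E y;
  exp_tr : forall x, tr (E x) = tr x }.

Lemma horner_alg_dexp y p N : horner_alg y (dexp N p) = dexp N (horner_alg y p).
Proof.
by rewrite /dexp rmorphXn rmorphD rmorph1 -!mul_polyC rmorphM /= horner_algC mulr_algl.
Qed.

Lemma nneg_dexp_quadratic b N : (0 < N)%N -> selfadjoint b -> nrm b <= 2^-1 ->
  nneg (1 + b + 2 *: b ^+ 2 - dexp N b).
Proof.
move=> N0 hb b1.
have -> : 1 + b + 2 *: b ^+ 2 - dexp N b =
    horner_alg b (1 + 'X + 2 *: 'X ^+ 2 - dexp N 'X).
  by rewrite !raddfB !raddfD /= linearZ /= rmorph1 rmorphXn /= horner_alg_dexp horner_algX mulr_algl.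
apply: poly_nneg => // t ht; rewrite /dexp !hornerE subr_ge0.
by rewrite /= -mulrA -expr2; apply: dexp_le_quadratic => //; exact: le_trans ht b1.
Qed.

Lemma nneg_dexp_pair x j i : (0 < j)%N -> selfadjoint x ->
  nneg (dexp (2 ^ (j + i)) x + dexp (2 ^ (j + i)) (- x) -
        ((2 ^ j)%:R^-1 *: x) ^+ (2 ^ j)).
Proof.
move=> j0 hx.
have -> : dexp (2 ^ (j + i)) x + dexp (2 ^ (j + i)) (- x) -
        ((2 ^ j)%:R^-1 *: x) ^+ (2 ^ j) =
    horner_alg x (dexp (2 ^ (j + i)) 'X + dexp (2 ^ (j + i)) (- 'X) -
        ((2 ^ j)%:R^-1 *: 'X) ^+ (2 ^ j)).
  rewrite raddfB raddfD /= !horner_alg_dexp rmorphXn /= linearZ /= raddfN /=.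
  by rewrite horner_algX mulr_algl.
apply: poly_nneg => // t _; rewrite /dexp !hornerE subr_ge0.
by rewrite mulrN; exact: monomial_le_dexp.
Qed.

Lemma nrm_opp_le x : nrm (- x) <= nrm x.
Proof. by rewrite -scaleN1r; apply: le_trans (nrmZ_le _ _) _; rewrite normrN1 mul1r. Qed.

(** Telescoping; [K >= 1] allows a crude power of [K] which makes the induction
    uniform. *)
Lemma nrm_exp_sub x y (K : R) n : 1 <= K -> nrm x <= K -> nrm y <= K ->
  nrm (x ^+ n - y ^+ n) <= n%:R * K ^+ n * nrm (x - y).
Proof.
move=> K1 hx hy; have K0 : 0 <= K by lra.
have d0 := nrm_ge0 (x - y).
elim: n => [|n IH].
  by rewrite !expr0 subrr mul0r mul0r; apply: opnorm_le => // u; rewrite /= hnorm0 mul0r.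
have -> : x ^+ n.+1 - y ^+ n.+1 = x ^+ n * (x - y) + (x ^+ n - y ^+ n) * y.
  by rewrite mulrBr mulrBl -!exprSr addrA subrK.
apply: le_trans (nrmD _ _) _.
have h1 : nrm (x ^+ n * (x - y)) <= K ^+ n.+1 * nrm (x - y).
  apply: le_trans (nrmM _ _) _; rewrite ler_wpM2r //.
  apply: le_trans (nrmX _ _) _; apply: (@le_trans _ _ (K ^+ n)).
    by rewrite lerXn2r ?nnegrE ?nrm_ge0.
  by rewrite ler_weXn2l.
have h2 : nrm ((x ^+ n - y ^+ n) * y) <= n%:R * K ^+ n.+1 * nrm (x - y).
  apply: le_trans (nrmM _ _) _.
  rewrite exprSr mulrA -mulrA (mulrC K) mulrA.
  by apply: ler_pM => //; exact: nrm_ge0.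
by apply: le_trans (lerD h1 h2) _; rewrite -natr1; lra.
Qed.

Lemma nrm_dexp_trotter a b N : (0 < N)%N ->
  nrm (dexp N (a + b) - ((1 + N%:R^-1 *: a) * (1 + N%:R^-1 *: b)) ^+ N) <=
  expR (nrm a + nrm b) * (nrm a * nrm b) / N%:R.
Proof.
move=> N0; set d : R := N%:R^-1.
have Ngt : 0 < (N%:R : R) by rewrite ltr0n.
have d0 : 0 <= d by rewrite invr_ge0 ltW.
have a0 := nrm_ge0 a; have b0 := nrm_ge0 b.
have nZ x : nrm (d *: x) <= d * nrm x by rewrite -{2}(ger0_norm d0) nrmZ_le.
have n1Z x : nrm (1 + d *: x) <= 1 + d * nrm x.
  by apply: le_trans (nrmD _ _) _; apply: lerD; [exact: nrm1 | exact: nZ].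
set K := expR (d * (nrm a + nrm b)).
have K1 : 1 <= K by rewrite -expR0 ler_expR mulr_ge0 // addr_ge0.
have hab : nrm (1 + d *: (a + b)) <= K.
  apply: le_trans (n1Z _) _; apply: le_trans (expR_ge1Dx _); rewrite lerD2l.
  by rewrite ler_wpM2l // nrmD.
have hprod : nrm ((1 + d *: a) * (1 + d *: b)) <= K.
  apply: le_trans (nrmM _ _) _; rewrite /K mulrDr expRD.
  by apply: ler_pM; rewrite ?nrm_ge0 //; exact: le_trans (n1Z _) (expR_ge1Dx _).
apply: le_trans (nrm_exp_sub _ K1 hab hprod) _.
have -> : K ^+ N = expR (nrm a + nrm b).
  by rewrite -expRM_natl mulrA mulfV ?mul1r ?gt_eqF.
have -> : 1 + d *: (a + b) - (1 + d *: a) * (1 + d *: b) = - (d *: a * (d *: b)).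
  rewrite scalerDr; move: (d *: a) (d *: b) => u v.
  have -> : (1 + u) * (1 + v) = 1 + (u + v) + u * v.
    by rewrite mulrDl mul1r mulrDr mulr1 addrA [1 + v + u]addrAC -[1 + u + v]addrA.
  by rewrite opprD addrA subrr add0r.
have hd : nrm (- (d *: a * (d *: b))) <= d * nrm a * (d * nrm b).
  apply: le_trans (nrm_opp_le _) _; apply: le_trans (nrmM _ _) _.
  by apply: ler_pM; rewrite ?nrm_ge0.
apply: (@le_trans _ _ (N%:R * expR (nrm a + nrm b) * (d * nrm a * (d * nrm b)))).
  by rewrite ler_wpM2l // mulr_ge0 ?expR_ge0 // ltW.
rewrite le_eqVlt; apply/orP; left; apply/eqP.
transitivity (N%:R * d * (expR (nrm a + nrm b) * (nrm a * nrm b) * d)); first by ring.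
by rewrite mulfV ?gt_eqF // mul1r.
Qed.

Section WithTrace.
Context (tr : op_elt S -> R).
Hypothesis htr : tracial_state tr.

Lemma trD x y : tr (x + y) = tr x + tr y.
Proof. by have := tr_linear htr 1 x y; rewrite scale1r mul1r. Qed.

Lemma tr0 : tr 0 = 0.
Proof. by apply: (addrI (tr 0)); rewrite -trD !addr0. Qed.

Lemma trZ r x : tr (r *: x) = r * tr x.
Proof. by have := tr_linear htr r x 0; rewrite !addr0 tr0 addr0. Qed.

Lemma trB x y : tr (x - y) = tr x - tr y.
Proof. by rewrite trD -scaleN1r trZ mulN1r. Qed.

Lemma tr_positive_trace : positive_trace (@elt_star _ _ _ S) tr.
Proof.
split; [exact: elt_starK | exact: elt_starB | exact: elt_star_mul | exact: trB
  | exact: tr_mulC | exact: tr_elt_star |].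
by move=> x; apply: (tr_nneg htr); exact: nneg_sq.
Qed.

Lemma tr_le x y : nneg (y - x) -> tr x <= tr y.
Proof. by move/(tr_nneg htr); rewrite trB subr_ge0. Qed.

(** [x] and its adjoint have the same trace, and half their sum is dominated by
    [|x|] times the identity. *)
Lemma tr_le_nrm x : tr x <= nrm x.
Proof.
have -> : tr x = tr (2^-1 *: (x + elt_star x)).
  by rewrite trZ trD (tr_elt_star htr); lra.
have -> : nrm x = tr (nrm x *: 1) by rewrite trZ (tr_one htr) mulr1.
apply: tr_le; apply: sa_nneg.
  apply: saB; first exact/saZ/sa1.
  by apply: saZ; rewrite /selfadjoint -[x in elt_star (x + _)]scale1r elt_starZD scale1r
     elt_starK addrC.
move=> u; rewrite eltBE !eltZE eltDE elt1E ripBl !ripZl ripDl.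
have -> : rip ip (elt_star x u) u = rip ip (x u) u.
  by rewrite ripC /rip -(elt_starP x).
have /ler_normlP[_ h] := rip_nrm x u; lra.
Qed.

(** The Golden-Thompson inequality for the discrete exponential. The error comes
    from replacing [1 + (a + b) / N] by [(1 + a / N) (1 + b / N)]. *)
Lemma tr_dexp_add_le a b k : selfadjoint a -> selfadjoint b ->
  tr (dexp (2 ^ k) (a + b)) <= tr (dexp (2 ^ k) a * dexp (2 ^ k) b) +
    expR (nrm a + nrm b) * (nrm a * nrm b) / (2 ^ k)%:R.
Proof.
move=> ha hb; set N := (2 ^ k)%N.
have N0 : (0 < N)%N by rewrite expn_gt0.
have h := le_trans (tr_le_nrm _) (nrm_dexp_trotter a b N0).
rewrite trB lerBlDr in h; apply: le_trans h _; rewrite addrC lerD2r.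
have sa1Z x : selfadjoint x -> selfadjoint (1 + N%:R^-1 *: x).
  by move=> hx; apply: saD; [exact: sa1 | exact: saZ].
exact: (proj2 (trace_exp_pow2 tr_positive_trace k)) (sa1Z _ ha) (sa1Z _ hb).
Qed.

(** The [2 ^ j]-th moment is dominated by two discrete exponential moments for
    every larger power of 2, so that the errors [B / 2 ^ k] disappear. *)
Lemma moment_le_of_dexp x (W B : R) j : (0 < j)%N -> selfadjoint x ->
  (forall k, (0 < k)%N -> tr (dexp (2 ^ k) x) <= W + B / (2 ^ k)%:R) ->
  (forall k, (0 < k)%N -> tr (dexp (2 ^ k) (- x)) <= W + B / (2 ^ k)%:R) ->
  tr (((2 ^ j)%:R^-1 *: x) ^+ (2 ^ j)) <= 2 * W.
Proof.
move=> j0 hx h1 h2; apply/ler_addgt0Pr => e e0.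
pose i := (Num.bound (2 * `|B| / e)).+1.
have pairing := tr_le (nneg_dexp_pair i j0 hx).
apply: le_trans pairing _; rewrite trD.
have ji0 : (0 < j + i)%N by rewrite addn_gt0 j0.
apply: le_trans (lerD (h1 _ ji0) (h2 _ ji0)) _.
have N0 : 0 < ((2 ^ (j + i))%:R : R) by rewrite ltr0n expn_gt0.
suff : 2 * (B / (2 ^ (j + i))%:R) <= e by lra.
rewrite mulrA ler_pdivrMr //; apply: (@le_trans _ _ (2 * `|B|)).
  by rewrite ler_pM2l // ler_norm.
rewrite [leRHS]mulrC -ler_pdivrMr //.
apply: le_trans (ltW (archi_boundP _)) _; first by rewrite divr_ge0 // ?mulr_ge0 // ltW.
rewrite ler_nat; apply: leq_trans (ltnW (ltn_expl _ (isT : 1 < 2)%N)) _.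
by rewrite leq_exp2l // /i -addSnnS leq_addl.
Qed.

Section WithExpectation.
Context (E : op_elt S -> op_elt S).
Hypothesis hE : expectation tr E.

Lemma expD x y : E (x + y) = E x + E y.
Proof. by have := exp_linear hE 1 x y; rewrite !scale1r. Qed.

Lemma exp0 : E 0 = 0.
Proof. by apply: (addrI (E 0)); rewrite -expD !addr0. Qed.

Lemma expZ r x : E (r *: x) = r *: E x.
Proof. by have := exp_linear hE r x 0; rewrite !addr0 exp0 addr0. Qed.

Lemma expB x y : E (x - y) = E x - E y.
Proof. by rewrite expD -scaleN1r expZ scaleN1r. Qed.

(** Independence and the module property replace [c] by [E c] in the trace of
    [y y c]; traciality then rotates it into [y (E c) y], which is at most [C y y]
    as an operator. *)
Lemma tr_mul_independent_le c y (C : R) : selfadjoint y ->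
  nneg (C *: 1 - E c) -> E (c * (y * y)) = E c * E (y * y) ->
  tr (y * y * c) <= C * tr (y * y).
Proof.
move=> hy hc hind.
rewrite (tr_mulC htr) -(exp_tr hE) hind -(exp_module hE) (exp_tr hE).
rewrite mulrA (tr_mulC htr) -trZ; apply: tr_le.
have := nneg_conj y hc; rewrite hy mulrBr mulrBl mulrA.
by rewrite -scalerAr mulr1 -scalerAl.
Qed.

Lemma nneg_exp_dexp b N (s : R) : (0 < N)%N -> selfadjoint b -> nrm b <= 2^-1 ->
  E b = 0 -> nneg (s *: 1 - E (b ^+ 2)) -> nneg ((1 + 2 * s) *: 1 - E (dexp N b)).
Proof.
move=> N0 hb b1 Eb Eb2.
have := exp_nneg hE (nneg_dexp_quadratic N0 hb b1).
rewrite expB !expD (exp_one hE) Eb addr0 expZ => h.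
have := nnegD h (nnegZ (ler0n R 2) Eb2); congr nneg.
move: (E (b ^+ 2)) (E (dexp N b)) => u v.
rewrite scalerBr scalerA scalerDl scale1r addrAC; congr (_ - _).
by rewrite -addrA [2 *: u + _]addrC subrK.
Qed.

(** The consequence of successive independence that the induction uses: the only
    elements which occur are powers of [1 + a_j / N] and of [1 + x / N], where [x]
    is the preceding partial sum. *)
Definition poly_independent n (a : 'I_n -> op_elt S) : Prop :=
  forall (j : 'I_n) p q,
    E (horner_alg (a j) p * horner_alg (\sum_(i < n | (i < j)%N) a i) q) =
    E (horner_alg (a j) p) * E (horner_alg (\sum_(i < n | (i < j)%N) a i) q).

Lemma tr_dexp_sum_le n (a : 'I_n -> op_elt S) (s : 'I_n -> R) :
  (forall j, selfadjoint (a j)) -> (forall j, nrm (a j) <= 2^-1) -> (forall j, 0 <= s j) ->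
  (forall j, E (a j) = 0) -> (forall j, nneg (s j *: 1 - E (a j ^+ 2))) ->
  poly_independent a ->
  exists B : R, forall k, (0 < k)%N ->
    tr (dexp (2 ^ k) (\sum_(j < n) a j)) <=
    expR (2 * \sum_(j < n) s j) + B / (2 ^ k)%:R.
Proof.
move=> a_sa a_nrm s0 Ea Ea2 ind.
pose X m := \sum_(i < n | (i < m)%N) a i.
pose V m := \sum_(i < n | (i < m)%N) s i.
have X_sa m : selfadjoint (X m).
  by apply: big_ind => //; [exact: sa0 | exact: saD].
have step m : (m <= n)%N -> exists2 B : R, 0 <= B & forall k, 
    tr (dexp (2 ^ k.+1) (X m)) <= expR (2 * V m) + B / (2 ^ k.+1)%:R.
  elim: m => [_|m IH mn].
    exists 0 => // k; rewrite /X /V !big_pred0 // mulr0 expR0 mul0r addr0.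
    by rewrite /dexp scaler0 addr0 expr1n (tr_one htr).
  have [B B0 hB] := IH (ltnW mn).
  pose j := Ordinal mn.
  have split (T : zmodType) (F : 'I_n -> T) :
      \sum_(i < n | (i < m.+1)%N) F i = \sum_(i < n | (i < m)%N) F i + F j.
    rewrite (bigD1 j) //= addrC; congr (_ + _); apply: eq_bigl => i.
    by rewrite ltnS (leq_eqVlt i m) -(inj_eq val_inj) /=; case: ltngtP.
  have XS : X m.+1 = X m + a j by exact: split.
  have VS : V m.+1 = V m + s j by exact: split.
  pose D := expR (nrm (X m) + nrm (a j)) * (nrm (X m) * nrm (a j)).
  have D0 : 0 <= D by rewrite !mulr_ge0 ?expR_ge0 ?nrm_ge0.
  exists (expR (2 * s j) * B + D) => [|k]; first by rewrite addr_ge0 // mulr_ge0 ?expR_ge0.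
  rewrite XS; apply: le_trans (tr_dexp_add_le _ (X_sa m) (a_sa j)) _.
  rewrite -/D [(_ + D) / _]mulrDl addrA lerD2r.
  set N := (2 ^ k.+1)%N; set y := (1 + N%:R^-1 *: X m) ^+ (2 ^ k).
  have yy : dexp N (X m) = y * y by rewrite /dexp /y -exprD /N expnS mul2n addnn.
  have y_sa : selfadjoint y by apply: saX; apply: saD; [exact: sa1 | exact: saZ].
  have hind : E (dexp N (a j) * (y * y)) = E (dexp N (a j)) * E (y * y).
    have := ind j (dexp N 'X) (dexp N 'X).
    by rewrite !horner_alg_dexp !horner_algX -/(X m) yy.
  have N0 : (0 < N)%N by rewrite expn_gt0.
  have hdexp := nneg_exp_dexp N0 (a_sa j) (a_nrm j) (Ea j) (Ea2 j).
  rewrite yy; apply: le_trans (tr_mul_independent_le y_sa hdexp hind) _.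
  have yy0 : 0 <= tr (y * y).
    by apply: (tr_nneg htr); rewrite -{1}y_sa; exact: nneg_sq.
  apply: (@le_trans _ _ (expR (2 * s j) * tr (y * y))).
    by rewrite ler_wpM2r // expR_ge1Dx.
  rewrite VS mulrDr expRD (mulrC (expR (2 * V m))) -mulrA -mulrDr.
  by rewrite ler_wpM2l ?expR_ge0 // -yy hB.
have [B B0 hB] := step n (leqnn n).
have full (T : zmodType) (F : 'I_n -> T) :
    \sum_(i < n | (i < n)%N) F i = \sum_(i < n) F i.
  by apply: eq_bigl => i; rewrite ltn_ord.
rewrite /X /V !full in hB.
by exists B => -[|k] // _; exact: hB.
Qed.

End WithExpectation.
End WithTrace.
End TraceMoments.

(** * Von Neumann algebras as operator algebras *)

Section VonNeumann.
Context (R : realType) (H : lmodType R[i]) (ip : {dot H for Num.conj}).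
Implicit Types (x y z : H -> H) (M N : set (H -> H)) (u v : H).

Lemma hnorm_complex_scale (c : R[i]) u :
  hnorm ip (c *: u) = Num.sqrt (complex.Re c ^+ 2 + complex.Im c ^+ 2) * hnorm ip u.
Proof.
apply/eqP; rewrite -(eqrXn2 (n := 2)) ?mulr_ge0 ?hnorm_ge0 ?sqrtr_ge0 //.
rewrite exprMn !hnorm_sq sqr_sqrtr ?addr_ge0 ?sqr_ge0 // /rip ipZl ipZr.
rewrite ip_rip; case: c => a b /=; apply/eqP; ring.
Qed.

Lemma bounded_op_lin (c : R[i]) x y :
  bounded_op ip x -> bounded_op ip y -> bounded_op ip (c *: x + y).
Proof.
move=> hx hy; split.
  move=> d u v; change ((c *: x + y) (d *: u + v)) with (c *: x (d *: u + v) + y (d *: u + v)).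
  rewrite !(bounded_opD hx) !(bounded_opD hy) !(bounded_opZ hx) !(bounded_opZ hy).
  change ((c *: x + y) u) with (c *: x u + y u).
  change ((c *: x + y) v) with (c *: x v + y v).
  by rewrite !scalerDr !scalerA (mulrC c) addrACA.
exists (Num.sqrt (complex.Re c ^+ 2 + complex.Im c ^+ 2) * opnorm ip x + opnorm ip y) => u.
apply: le_trans (hnorm_triangle _ _ _) _; rewrite mulrDl; apply: lerD.
  by rewrite hnorm_complex_scale -mulrA ler_wpM2l ?sqrtr_ge0 // hnorm_op.
exact: hnorm_op.
Qed.

Lemma bounded_op_comp x y :
  bounded_op ip x -> bounded_op ip y -> bounded_op ip (x \o y).
Proof.
move=> hx hy; split.
  by move=> d u v /=; rewrite (bounded_opD hy) (bounded_opZ hy) (bounded_opD hx) (bounded_opZ hx).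
exists (opnorm ip x * opnorm ip y) => u /=.
apply: le_trans (hnorm_op _ hx) _; rewrite -mulrA.
by rewrite ler_wpM2l ?opnorm_ge0 // hnorm_op.
Qed.

Lemma commutant_unital (T : set (H -> H)) :
  (forall x, T x -> bounded_op ip x) -> unital_subalgebra (commutant ip T).
Proof.
move=> hT; split.
- by split=> [|x _ //]; split=> [d u v //|]; exists 1 => u; rewrite mul1r.
- move=> c x y [hx cx] [hy cy]; split; first exact: bounded_op_lin.
  move=> z Tz; apply/funext => u /=.
  have hz := hT z Tz.
  change (z (c *: x u + y u) = c *: x (z u) + y (z u)).
  rewrite (bounded_opD hz) (bounded_opZ hz).
  by have /= -> := congr1 (@^~ u) (cx z Tz); have /= -> := congr1 (@^~ u) (cy z Tz).
- move=> x y [hx cx] [hy cy]; split; first exact: bounded_op_comp.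
  by move=> z Tz; rewrite compA (cx z Tz) -compA (cy z Tz).
Qed.

Lemma vn_unital M : von_neumann_algebra ip M -> unital_subalgebra M.
Proof. by case=> _ _ <-; apply: commutant_unital => x []. Qed.

(** A commutant is norm-closed, and [M] is the commutant of its commutant. *)
Lemma vn_norm_closed M y : von_neumann_algebra ip M -> bounded_op ip y ->
  (forall e : R, 0 < e -> exists2 z, M z & opnorm ip (z - y) <= e) -> M y.
Proof.
case=> hb _ hM by_ lim; rewrite -hM; split=> // x [hx cx].
apply/funext => u /=; apply/eqP; rewrite -subr_eq0; apply/eqP.
apply: (@hnorm_eq0 _ _ ip); apply/eqP; rewrite eq_le hnorm_ge0 andbT.
apply/ler_addgt0Pr => e e0; rewrite add0r.
(* the summand 1 keeps [K] positive when [x] or [u] vanishes *)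
pose K := 2 * (opnorm ip x * hnorm ip u) + 1.
have xu0 : 0 <= opnorm ip x * hnorm ip u by rewrite mulr_ge0 ?hnorm_ge0 ?opnorm_ge0.
have K0 : 0 < K by rewrite /K; lra.
have [z Mz hz] := lim (e / K) (divr_gt0 e0 K0).
have bz : bounded_op ip (z - y).
  by rewrite addrC -scaleN1r; apply: bounded_op_lin => //; exact: hb.
have zx : x (z u) = z (x u) by have /= -> := congr1 (@^~ u) (cx z Mz).
have -> : x (y u) - y (x u) = (z - y) (x u) - x ((z - y) u).
  change (x (y u) - y (x u) = z (x u) - y (x u) - x (z u - y u)).
  rewrite (bounded_opD hx) -[- y u]scaleN1r (bounded_opZ hx) scaleN1r zx.
  by rewrite opprB [RHS]addrC addrA subrK.
apply: le_trans (hnorm_triangle _ _ _) _; rewrite hnorm_opp.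
have h1 : hnorm ip ((z - y) (x u)) <= (e / K) * (opnorm ip x * hnorm ip u).
  apply: le_trans (hnorm_op _ bz) _; apply: ler_pM => //; rewrite ?opnorm_ge0 ?hnorm_ge0 //.
  exact: hnorm_op.
have h2 : hnorm ip (x ((z - y) u)) <= (e / K) * (opnorm ip x * hnorm ip u).
  apply: le_trans (hnorm_op _ hx) _; rewrite mulrCA ler_wpM2l ?opnorm_ge0 //.
  by apply: le_trans (hnorm_op _ bz) _; rewrite ler_wpM2r ?hnorm_ge0.
apply: le_trans (lerD h1 h2) _.
have -> : e = e / K * K by rewrite divfK // gt_eqF.
rewrite mulfK ?gt_eqF // -mulrDr ler_wpM2l ?divr_ge0 ?(ltW e0) ?(ltW K0) //.
by rewrite /K; lra.
Qed.

Lemma vn_op_algebra M : von_neumann_algebra ip M -> idfun <> 0 :> (H -> H) ->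
  exists S : op_algebra ip, opa_set S = M.
Proof.
move=> hM h1; have [hb ha _] := hM.
by exists (OpAlgebra (vn_unital hM) hb ha h1).
Qed.

End VonNeumann.

(** * Norm limits of polynomials in an operator *)

Section OperatorFunctionalCalculus.
Context (R : realType) (H : lmodType R[i]) (ip : {dot H for Num.conj}).
Context (S : op_algebra ip).
Implicit Types (x y : op_elt S) (p q : {poly R}).

Lemma horner_algE x p : horner_alg x p = \sum_(k < size p) p`_k *: x ^+ k.
Proof.
rewrite -{1}[p]coefK poly_def raddf_sum; apply: eq_bigr => k _.
by rewrite /= linearZ /= rmorphXn /= horner_algX mulr_algl.
Qed.

Lemma op_of_polyE x p : op_of (horner_alg x p) = op_poly p x.
Proof.
rewrite horner_algE /op_poly.
rewrite (big_morph (@op_of _ _ _ S) (id1 := 0) (op1 := +%R)) //.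
apply: eq_bigr => k _; congr (_ *: _).
by elim: (k : nat) => [|m IH] //=; rewrite exprS -IH.
Qed.

Lemma horner_alg_comp x p q : horner_alg x (p \Po q) = horner_alg (horner_alg x q) p.
Proof.
rewrite comp_polyE raddf_sum /= horner_algE; apply: eq_bigr => k _.
by rewrite linearZ /= rmorphXn mulr_algl.
Qed.

Lemma horner_alg0 p : horner_alg (0 : op_elt S) p = p`_0 *: 1.
Proof.
elim/poly_ind: p => [|p c _]; first by rewrite raddf0 coef0 scale0r.
by rewrite raddfD /= rmorphM /= horner_algX horner_algC mulr0 add0r coefD coefMX coefC add0r.
Qed.

Lemma unital_horner_alg (U : set (H -> H)) x p :
  unital_subalgebra U -> U x -> U (horner_alg x p).
Proof.
move=> [U1 Ulin Umul] Ux; elim/poly_ind: p => [|p c IH].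
  by rewrite raddf0; have := Ulin (-1) _ _ U1 U1; rewrite scaleN1r addNr.
rewrite raddfD /= rmorphM /= horner_algX horner_algC addrC.
exact: (Ulin c%:C _ _ U1 (Umul _ _ IH Ux)).
Qed.

Lemma unital_sum (U : set (H -> H)) (I : Type) (r : seq I) (P : pred I)
    (F : I -> op_elt S) :
  unital_subalgebra U -> (forall i, P i -> U (F i)) -> U (\sum_(i <- r | P i) F i).
Proof.
move=> [U1 Ulin _] UF; apply: (big_ind (fun x : op_elt S => U x)) => //.
  by have := Ulin (-1) _ _ U1 U1; rewrite scaleN1r addNr.
by move=> x y Ux Uy; have := Ulin 1 _ _ Ux Uy; rewrite scale1r.
Qed.

Lemma nrm_le0 x : nrm x <= 0 -> x = 0.
Proof.
move=> h; apply: op_elt_inj => u; apply: (@hnorm_eq0 _ _ ip).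
apply/eqP; rewrite eq_le hnorm_ge0 andbT; apply: le_trans (hnorm_nrm x u) _.
by rewrite mulr_le0_ge0 ?hnorm_ge0.
Qed.

(** [|x^* u|^2] is the inner product of [x x^* u] with [u]. *)
Lemma nrm_star_le x : nrm (elt_star x) <= nrm x.
Proof.
apply: opnorm_le => [|u]; first exact: nrm_ge0.
have [->|u0] := eqVneq (hnorm ip (elt_star x u)) 0.
  by rewrite mulr_ge0 ?nrm_ge0 ?hnorm_ge0.
have up : 0 < hnorm ip (elt_star x u) by rewrite lt_def u0 hnorm_ge0.
rewrite -(ler_pM2l up) -expr2 hnorm_sq.
have -> : rip ip (elt_star x u) (elt_star x u) = rip ip (x (elt_star x u)) u.
  by rewrite /rip (elt_starP x).
apply: le_trans (cauchy_schwarz _ _ _) _; rewrite mulrA ler_wpM2r ?hnorm_ge0 //.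
by rewrite mulrC; exact: hnorm_nrm.
Qed.

Lemma sa_limit y : (forall e : R, 0 < e -> exists2 x, selfadjoint x & nrm (x - y) <= e) -> selfadjoint y.
Proof.
move=> lim; apply/eqP; rewrite -subr_eq0; apply/eqP/nrm_le0/ler_addgt0Pr => e e0.
rewrite add0r; have [x hx hxy] := lim (e / 2) (divr_gt0 e0 (ltr0n _ 2)).
have -> : elt_star y - y = (x - y) - elt_star (x - y).
  by rewrite elt_starB hx opprB [RHS]addrC addrA subrK.
apply: le_trans (nrmD _ _) _; have := nrm_opp_le (elt_star (x - y)).
have := nrm_star_le (x - y); lra.
Qed.

(** The approximation clause of [is_fun_calc], with polynomials evaluated in the
    ring of elements; boundedness of [y] is part of its type. *)
Definition approx_calc (f : R -> R) x y : Prop :=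
  forall e : R, 0 < e -> exists p : {poly R},
    (forall t, `|t| <= nrm x -> `|p.[t] - f t| <= e) /\ nrm (horner_alg x p - y) <= e.

Lemma approx_calc_sa f x y : selfadjoint x -> approx_calc f x y -> selfadjoint y.
Proof.
move=> hx h; apply: sa_limit => e e0; have [p [_ hp]] := h e e0.
by exists (horner_alg x p) => //; exact: sa_poly.
Qed.

(** [|x|^2 = x^2]. The approximations are read as polynomials [q(t^2)] in [x]
    rather than in [x^2], because [sqrt] is compared with [|t|] only at the
    nonnegative points [t^2]. *)
Lemma approx_calc_sqrt_sq x y : selfadjoint x -> approx_calc Num.sqrt (x * x) y ->
  y ^+ 2 = x ^+ 2.
Proof.
move=> hx h; set c := nrm x; set b := nrm y.
have c0 : 0 <= c by exact: nrm_ge0.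
have b0 : 0 <= b by exact: nrm_ge0.
apply/eqP; rewrite -subr_eq0; apply/eqP/nrm_le0/ler_addgt0Pr => e e0.
rewrite add0r.
pose K := 2 + 2 * c + 2 * b; have K0 : 0 < K by rewrite /K; lra.
(* [d <= 1] turns the quadratic error terms below into linear ones *)
pose d := Num.min 1 (e / K).
have d0 : 0 < d by rewrite lt_min ltr01 divr_gt0.
have d1 : d <= 1 by rewrite ge_min lexx.
have dK : d * K <= e by rewrite -ler_pdivlMr // ge_min lexx orbT.
have [q [hq hqy]] := h d d0.
set P := horner_alg (x * x) q in hqy.
have PE : P = horner_alg x (q \Po 'X ^+ 2).
  by rewrite horner_alg_comp rmorphXn /= horner_algX expr2.
have hPx : nrm (P ^+ 2 - x ^+ 2) <= d * (d + 2 * c).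
  have -> : P ^+ 2 - x ^+ 2 = horner_alg x ((q \Po 'X ^+ 2) ^+ 2 - 'X ^+ 2).
    by rewrite raddfB /= rmorphXn /= -PE rmorphXn /= horner_algX.
  apply: poly_nrm_le => //; first by rewrite mulr_ge0 //; lra.
  move=> t ht; rewrite hornerD hornerN !horner_exp horner_comp horner_exp hornerX.
  have t0 : 0 <= `|t| by [].
  have := hq (t ^+ 2); rewrite sqrtr_sqr => /(_ _)/wrap[].
    rewrite normrX; apply: le_trans (_ : c ^+ 2 <= _); first by rewrite lerXn2r ?nnegrE.
    by rewrite -expr2; exact: nrm_sq.
  rewrite -[t ^+ 2 in X in _ -> X]real_normK ?num_real // -(real_normK (num_real t)).
  set s := q.[_] => hs; rewrite subr_sqr normrM.
  apply: ler_pM => //.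
  have -> : s + `|t| = (s - `|t|) + 2 * `|t| by ring.
  apply: le_trans (ler_normD _ _) _; rewrite normrM normr_id (ger0_norm (ler0n R 2)).
  by apply: lerD => //; rewrite ler_wpM2l.
have hyP : nrm (y ^+ 2 - P ^+ 2) <= d * (2 * b + d).
  have -> : y ^+ 2 - P ^+ 2 = - ((P - y) * y + P * (P - y)).
    by rewrite mulrBl mulrBr !expr2 [P * y - _ + _]addrC addrA subrK opprB.
  apply: le_trans (nrm_opp_le _) _; apply: le_trans (nrmD _ _) _.
  have nP : nrm P <= b + d.
    have {1}-> : P = y + (P - y) by rewrite addrC subrK.
    by apply: le_trans (nrmD _ _) _; rewrite lerD2l.
  have h1 : nrm ((P - y) * y) <= d * b.
    by apply: le_trans (nrmM _ _) _; rewrite ler_wpM2r.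
  have h2 : nrm (P * (P - y)) <= (b + d) * d.
    by apply: le_trans (nrmM _ _) _; apply: ler_pM; rewrite ?nrm_ge0.
  by apply: le_trans (lerD h1 h2) _; rewrite le_eqVlt; apply/orP; left; apply/eqP; ring.
have -> : y ^+ 2 - x ^+ 2 = (y ^+ 2 - P ^+ 2) + (P ^+ 2 - x ^+ 2) by rewrite addrA subrK.
apply: le_trans (nrmD _ _) _; apply: le_trans (lerD hyP hPx) _.
apply: le_trans dK; rewrite /K; nra.
Qed.

(** The bound [|t|^p <= K^p (1 + (t / K)^Q)] is transferred to the approximating
    polynomials, where [poly_nneg] applies, and then to the limit. The lower bound
    is needed because [powR] is not monotone on the negative numbers. *)
Lemma approx_calc_pow_trace (tr : op_elt S -> R) (p K : R) Q x y :
  tracial_state tr -> selfadjoint x -> 0 < p -> p <= Q%:R -> 0 < K -> ~~ odd Q ->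
  approx_calc (fun t => `|t| `^ p) x y ->
  0 <= tr y <= K `^ p * (1 + K^-1 ^+ Q * tr (x ^+ Q)).
Proof.
move=> htr hx p0 pQ K0 evQ h.
have near e : 0 < e -> exists q : {poly R},
    [/\ forall t, `|t| <= nrm x -> `|q.[t] - `|t| `^ p| <= e,
        tr y <= tr (horner_alg x q) + e & tr (horner_alg x q) <= tr y + e].
  move=> e0; have [q [hq hqy]] := h e e0; exists q; split => //.
  - rewrite addrC -lerBlDr -(trB htr); apply: le_trans (tr_le_nrm htr _) _.
    by rewrite -opprB; exact: le_trans (nrm_opp_le _) hqy.
  - rewrite addrC -lerBlDr -(trB htr).
    exact: le_trans (tr_le_nrm htr _) hqy.
apply/andP; split; apply/ler_addgt0Pr => e e0.
  have [q [hq _ hy]] := near (e / 2) (divr_gt0 e0 (ltr0n _ 2)).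
  have := @poly_nneg _ _ _ _ x (q + (e / 2)%:P) hx.
  have /[swap]/[apply] : forall t, `|t| <= nrm x -> 0 <= (q + (e / 2)%:P).[t].
    move=> t /hq; rewrite !hornerE ler_norml => /andP[ht _].
    by have := powR_ge0 `|t| p; lra.
  move=> /(tr_nneg htr); rewrite raddfD /= horner_algC (trD htr) (trZ htr) (tr_one htr).
  by move: hy; lra.
have [q [hq hy _]] := near (e / 2) (divr_gt0 e0 (ltr0n _ 2)).
pose P : {poly R} := K `^ p *: (1 + K^-1 ^+ Q *: 'X ^+ Q).
have trP : tr (horner_alg x P) = K `^ p * (1 + K^-1 ^+ Q * tr (x ^+ Q)).
  rewrite /P linearZ /= mulr_algl (trZ htr) raddfD /= (trD htr) rmorph1 (tr_one htr).
  by rewrite linearZ /= mulr_algl (trZ htr) rmorphXn /= horner_algX.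
have := @poly_nneg _ _ _ _ x (P + (e / 2)%:P - q) hx.
have /[swap]/[apply] : forall t, `|t| <= nrm x -> 0 <= (P + (e / 2)%:P - q).[t].
  move=> t /hq; rewrite hornerD hornerN hornerD hornerC hornerZ hornerD hornerZ hornerXn.
  rewrite -[1 : {poly R}]/(1%:P) hornerC ler_norml => /andP[_ ht].
  by have := @powR_le_moment _ p K t Q p0 pQ K0 evQ; lra.
move=> /(tr_nneg htr); rewrite raddfB raddfD /= horner_algC (trB htr) (trD htr) trP.
by rewrite (trZ htr) (tr_one htr); move: hy; lra.
Qed.

(** The limit belongs to the algebra, which is norm-closed. The second alternative
    is the default value of [fun_calc]; it can only make the trace smaller. *)
Lemma fun_calc_elt (f : R -> R) x :
  von_neumann_algebra ip (opa_set S) ->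
  exists y : op_elt S, op_of y = fun_calc ip f x /\ (approx_calc f x y \/ y = 0).
Proof.
move=> hS; rewrite /fun_calc; case: xgetP => [y _ [by_ hy]|_]; last first.
  by exists 0; split => //; right.
have Sy : opa_set S y.
  apply: (vn_norm_closed hS by_) => e e0; have [q [_ hq]] := hy e e0.
  by exists (op_poly q x) => //; rewrite -op_of_polyE; exact: op_ofP.
exists (OpElt Sy); split => //; left => e e0; have [q [h1 h2]] := hy e e0.
by exists q; split => //; rewrite /nrm /=; rewrite -op_of_polyE in h2.
Qed.

End OperatorFunctionalCalculus.

(** * The state and the conditional expectation on elements *)

Section StateTransfer.
Context (R : realType) (H : lmodType R[i]) (ip : {dot H for Num.conj}).
Context (S : op_algebra ip) (tau : (H -> H) -> R[i]).
Hypothesis htau : normal_faithful_tracial_state ip (opa_set S) tau.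
Implicit Types (x y : op_elt S).

Definition re_trace x : R := complex.Re (tau x).

Let tau_lin (c : R[i]) x y : tau (c *: op_of x + op_of y) = c * tau x + tau y.
Proof. by apply: (state_linear htau); exact: op_ofP. Qed.

Let state0 : tau (op_of (0 : op_elt S)) = 0.
Proof.
have := tau_lin 1 0 0; rewrite scale1r mul1r.
have -> : op_of (0 : op_elt S) + op_of (0 : op_elt S) = op_of (0 : op_elt S).
  by apply/funext => u; exact: addr0.
by move=> /eqP; rewrite -subr_eq0 opprD addNKr oppr_eq0 => /eqP.
Qed.

(** [|x| - x] is positive, so its trace is real. *)
Lemma state_sa_real x : selfadjoint x -> complex.Im (tau x) = 0.
Proof.
move=> hx; have := state_pos htau (op_ofP _) (nneg_nrm hx).
have -> : op_of (nrm x *: 1 - x) = (-1) *: op_of x + op_of (nrm x *: 1 : op_elt S).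
  by apply/funext => u; rewrite eltBE addrC -scaleN1r.
rewrite tau_lin.
have -> : op_of (nrm x *: 1 : op_elt S) = (nrm x)%:C *: op_of (1 : op_elt S) + op_of (0 : op_elt S).
  by apply/funext => u; rewrite eltZE; exact/esym/addr0.
rewrite tau_lin (state_one htau) state0.
move/ger0_Im; case: (tau x) => a b /=.
by rewrite !(mulr0, mul0r, mulN1r, mulr1, addr0, add0r, oppr0, mul1r) => /eqP;
   rewrite oppr_eq0 => /eqP.
Qed.

Lemma re_traceZD (r : R) x y : re_trace (r *: x + y) = r * re_trace x + re_trace y.
Proof.
rewrite /re_trace; have -> : op_of (r *: x + y) = r%:C *: op_of x + op_of y by [].
by rewrite tau_lin ReD ReZ.
Qed.

(** The skew part [x - x^*] has a self-adjoint multiple, so that its trace is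
    purely imaginary. *)
Lemma re_trace_star x : re_trace (elt_star x) = re_trace x.
Proof.
pose iu : R[i] := 0 +i* 1; pose d := (-1) *: op_of (elt_star x) + op_of x.
have Sd : opa_set S d by apply: opa_lin; exact: op_ofP.
pose y : op_elt S := OpElt (opa_scale iu Sd).
have hy : selfadjoint y.
  apply: elt_star_unique => u v.
  change (ip (iu *: (-1 *: elt_star x u + x u)) v =
          ip u (iu *: (-1 *: elt_star x v + x v))).
  rewrite ipZl ipDl ipZl ipZr ipDr ipZr (elt_starP (elt_star x)) elt_starK (elt_starP x).
  rewrite rmorphN rmorph1; have -> : Num.conj iu = - iu.
    by apply/eqP; rewrite eq_complex /= oppr0 !eqxx.
  by ring.
have := state_sa_real hy.
have -> : op_of y = iu *: op_of (OpElt Sd) + op_of (0 : op_elt S).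
  by apply/funext => u; exact/esym/addr0.
rewrite tau_lin tau_lin state0.
rewrite /re_trace; case: (tau (elt_star x)) => a b; case: (tau x) => a' b' /=.
lra.
Qed.

Lemma re_trace_state : tracial_state re_trace.
Proof.
split.
- exact: re_traceZD.
- by move=> x y; congr complex.Re; apply: (state_tracial htau); exact: op_ofP.
- exact: re_trace_star.
- move=> x hx; have := state_pos htau (op_ofP x) hx.
  by rewrite lecE => /andP[].
- by rewrite /re_trace (state_one htau).
Qed.

Context (N : set (H -> H)) (E : (H -> H) -> H -> H).
Hypothesis NS : N `<=` opa_set S.
Hypothesis N1 : N idfun.
Hypothesis hE : conditional_expectation ip (opa_set S) N tau E.

Definition elt_exp x : op_elt S := OpElt (NS (cexp_in hE (op_ofP x))).

Lemma elt_exp_expectation : expectation re_trace elt_exp.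
Proof.
split.
- move=> r x y; apply: op_elt_inj => u /=.
  by rewrite -(cexp_linear hE r%:C (op_ofP x) (op_ofP y)).
- by apply: op_elt_inj => u /=; rewrite (cexp_one hE).
- by move=> x hx; exact: (cexp_pos hE (op_ofP x) hx).
- move=> x y; apply: op_elt_inj => u.
  have := cexp_bimodule hE (cexp_in hE (op_ofP x)) N1 (op_ofP y).
  by move=> /(congr1 (@^~ u)).
- by move=> x; rewrite /re_trace /= (cexp_state hE (op_ofP x)).
Qed.

End StateTransfer.

(** * The moment inequality *)

Section Bernstein.
Context (R : realType) (H : lmodType R[i]) (ip : {dot H for Num.conj}).
Context (S : op_algebra ip) (tr : op_elt S -> R) (E : op_elt S -> op_elt S).
Hypothesis htr : tracial_state tr.
Hypothesis hE : expectation tr E.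
Context (n : nat) (a : 'I_n -> op_elt S) (sigma Mb : 'I_n -> R).
Hypothesis a_sa : forall j, selfadjoint (a j).
Hypothesis Ea : forall j, E (a j) = 0.
Hypothesis Ea2 : forall j, nneg (sigma j ^+ 2 *: 1 - E (a j ^+ 2)).
Hypothesis a_nrm : forall j, nrm (a j) <= Mb j.
Hypothesis ind : forall r : R, poly_independent E (fun j => r *: a j).

(** The parameter [lam = p / (2 T)] makes [lam * Mb i <= 1 / 2] and
    [2 * lam^2 * V <= p / 2]. Both signs of [lam] are needed to extract a moment. *)
Lemma moment_bound (p T : R) j : 0 < p -> 0 < T -> (0 < j)%N ->
  (2 ^ j)%:R <= 2 * p ->
  p * \sum_(i < n) sigma i ^+ 2 <= T ^+ 2 -> (forall i, p * Mb i <= T) ->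
  (4 * T)^-1 ^+ (2 ^ j) * tr ((\sum_(i < n) a i) ^+ (2 ^ j)) <= 2 * expR (p / 2).
Proof.
move=> p0 T0 j0 jp hV hM; set X := \sum_(i < n) a i; set Q := (2 ^ j)%N.
have Q0 : 0 < (Q%:R : R) by rewrite ltr0n expn_gt0.
pose lam := p / (2 * T); have lam0 : 0 < lam by rewrite divr_gt0 // mulr_gt0.
have X_sa : selfadjoint X by apply: big_ind => //; [exact: sa0 | exact: saD].
have key r : `|r| = lam -> exists B : R, forall k, (0 < k)%N ->
    tr (dexp (2 ^ k) (r *: X)) <= expR (p / 2) + B / (2 ^ k)%:R.
  move=> hr; have r2 : r ^+ 2 = lam ^+ 2 by rewrite -hr real_normK ?num_real.
  have [] := @tr_dexp_sum_le _ _ _ _ _ htr _ hE n (fun i => r *: a i)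
     (fun i => lam ^+ 2 * sigma i ^+ 2).
  - by move=> i; exact: saZ.
  - move=> i; apply: le_trans (nrmZ_le _ _) _; rewrite hr /lam.
    have := le_trans (ler_wpM2l (ltW p0) (a_nrm i)) (hM i).
    rewrite mulrAC ler_pdivrMr ?mulr_gt0 //; lra.
  - by move=> i; rewrite mulr_ge0 ?sqr_ge0.
  - by move=> i; rewrite (expZ hE) Ea scaler0.
  - move=> i; have := nnegZ (sqr_ge0 lam) (Ea2 i); congr nneg.
    by rewrite scalerBr scalerA exprZn (expZ hE) r2.
  - exact: ind.
  move=> B hB; exists B => k k0; have := hB k k0.
  rewrite -scaler_sumr => h; apply: le_trans h _; rewrite lerD2r ler_expR -mulr_sumr.
  have e : lam ^+ 2 * (4 * T ^+ 2) = p ^+ 2.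
    by rewrite /lam; field; rewrite gt_eqF.
  have T2 : 0 < 4 * T ^+ 2 by rewrite mulr_gt0 // exprn_gt0.
  rewrite -(ler_pM2r T2); set V := \sum_(i < n) _ in hV *.
  have -> : 2 * (lam ^+ 2 * V) * (4 * T ^+ 2) = 2 * p * (p * V).
    by rewrite -[RHS]mulr1; transitivity (2 * V * (lam ^+ 2 * (4 * T ^+ 2))); [ring | rewrite e; ring].
  have -> : p / 2 * (4 * T ^+ 2) = 2 * p * T ^+ 2 by field.
  by rewrite ler_pM2l ?mulr_gt0.
have [B1 h1] := key lam (gtr0_norm lam0).
have [B2 h2] := key (- lam) (etrans (normrN _) (gtr0_norm lam0)).
pose B := `|B1| + `|B2|.
have hB b k : b <= B -> expR (p / 2) + b / (2 ^ k)%:R <= expR (p / 2) + B / (2 ^ k)%:R.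
  by move=> hb; rewrite lerD2l ler_wpM2r // invr_ge0.
have B1B : B1 <= B by apply: le_trans (ler_norm _) _; rewrite lerDl.
have B2B : B2 <= B by apply: le_trans (ler_norm _) _; rewrite lerDr.
have h1B k : (0 < k)%N ->
    tr (dexp (2 ^ k) (lam *: X)) <= expR (p / 2) + B / (2 ^ k)%:R.
  by move=> k0; exact: le_trans (h1 k k0) (hB _ _ B1B).
have h2B k : (0 < k)%N ->
    tr (dexp (2 ^ k) (- (lam *: X))) <= expR (p / 2) + B / (2 ^ k)%:R.
  by move=> k0; rewrite -scaleNr; exact: le_trans (h2 k k0) (hB _ _ B2B).
have := moment_le_of_dexp htr j0 (saZ lam X_sa) h1B h2B.
rewrite scalerA exprZn (trZ htr); apply: le_trans.
have trX0 : 0 <= tr (X ^+ Q).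
  by apply: (tr_nneg htr); apply: nneg_exp_even => //; exact: even_pow2.
have u0 : 0 <= (4 * T)^-1 by rewrite invr_ge0 mulr_ge0 // ltW.
have v0 : 0 <= (Q%:R)^-1 * lam by rewrite mulr_ge0 ?invr_ge0 ?ltW.
rewrite ler_wpM2r // lerXn2r ?nnegrE //.
rewrite [leRHS]mulrC /lam ler_pdivlMr // [leLHS]mulrC ler_pdivrMr ?mulr_gt0 //.
have -> : p / (2 * T) * (4 * T) = 2 * p by field; rewrite gt_eqF.
by [].
Qed.

(** [y1] stands for [|X|] and [y2] for [|X|^p]. In the degenerate case [y1 = 0] the
    moment of [y1] vanishes, and the bound by the moment of [X] still holds. *)
Lemma Lp_bound (p T : R) y1 y2 : 2 <= p -> 0 < T ->
  p * \sum_(i < n) sigma i ^+ 2 <= T ^+ 2 -> (forall i, p * Mb i <= T) ->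
  let X := \sum_(i < n) a i in
  approx_calc Num.sqrt (X * X) y1 \/ y1 = 0 ->
  approx_calc (fun t => `|t| `^ p) y1 y2 \/ y2 = 0 ->
  tr y2 `^ p^-1 <= 4 * expR 2 * T.
Proof.
move=> p2 T0 hV hM X h1 h2; have p0 : 0 < p by lra.
have X_sa : selfadjoint X by apply: big_ind => //; [exact: sa0 | exact: saD].
have [j j0 /andP[pj jp]] := pow2_between p2.
set Q := (2 ^ j)%N in pj jp.
have evQ : ~~ odd Q by exact: even_pow2.
pose K := 4 * T; have K0 : 0 < K by rewrite mulr_gt0.
have trX0 : 0 <= tr (X ^+ Q) by apply: (tr_nneg htr); exact: nneg_exp_even.
have y1_sa : selfadjoint y1.
  by case: h1 => [|->]; [apply: approx_calc_sa; rewrite -expr2; exact: saX | exact: sa0].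
have y1Q : tr (y1 ^+ Q) <= tr (X ^+ Q).
  case: h1 => [h|->].
    rewrite -(even_halfK evQ) -mul2n !exprM.
    by rewrite (approx_calc_sqrt_sq X_sa h).
  by rewrite expr0n expn_eq0 /= (tr0 htr).
have bound : 0 <= tr y2 <= K `^ p * expR (2 * p).
  case: h2 => [h|->]; last first.
    by rewrite (tr0 htr) lexx mulr_ge0 ?powR_ge0 ?expR_ge0.
  have /andP[-> hy] := approx_calc_pow_trace htr y1_sa p0 pj K0 evQ h.
  apply: le_trans hy _; rewrite ler_wpM2l ?powR_ge0 //.
  apply: le_trans (expR_bound p2); rewrite lerD2l.
  apply: le_trans (moment_bound p0 T0 j0 jp hV hM).
  by rewrite ler_wpM2l // exprn_ge0 // invr_ge0 ltW.
have /andP[y0 y2K] := bound.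
have -> : 4 * expR 2 * T = (K `^ p * expR (2 * p)) `^ p^-1.
  rewrite powRM ?powR_ge0 ?expR_ge0 // -powRrM -expRM mulfK ?gt_eqF //.
  by rewrite mulfV ?gt_eqF // powRr1 ?(ltW K0) // /K; ring.
by rewrite ge0_ler_powR ?nnegrE // ?invr_ge0 ?(ltW p0) // mulr_ge0 ?powR_ge0 ?expR_ge0.
Qed.

End Bernstein.

Theorem corollary0p3 (R : realType) :
  exists C : R,
  forall (p : R) (H : lmodType R[i]) (ip : {dot H for Num.conj})
    (M N : set (H -> H)) (tau : (H -> H) -> R[i]) (E : (H -> H) -> H -> H)
    (n : nat) (A : 'I_n -> set (H -> H)) (a : 'I_n -> H -> H)
    (sigma Mb : 'I_n -> R),
  2 <= p ->
  hilbert_complete ip ->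
  von_neumann_algebra ip M ->
  normal_faithful_tracial_state ip M tau ->
  von_neumann_algebra ip N -> N `<=` M ->
  conditional_expectation ip M N tau E ->
  (forall j, [/\ von_neumann_algebra ip (A j), N `<=` A j & A j `<=` M]) ->
  successively_independent E A ->
  (forall j, A j (a j) /\ is_adjoint ip (a j) (a j)) ->
  (forall j, 0 <= sigma j /\ 0 <= Mb j) ->
  (forall j, E (a j) = 0) ->
  (forall j, op_le ip (E (a j \o a j)) ((sigma j ^+ 2)%:C *: idfun)) ->
  (forall j, opnorm ip (a j) <= Mb j) ->
  Lp_norm ip tau p (\sum_(j < n) a j) <=
    C * (Num.sqrt (p * \sum_(j < n) sigma j ^+ 2) + p * sup (range Mb)).
Proof.
exists (4 * expR 2) => p H ip M N tau E n A a sigma Mb p2 _ hM htau hN NM hE hA hind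
  ha hpos Ea Ea2 a_nrm.
have one_neq0 : idfun <> 0 :> (H -> H).
  move=> h; have M1 : M idfun by case: (vn_unital hM).
  have := state_linear htau 1 M1 M1; rewrite {1}h scaler0 add0r (state_one htau) mul1r.
  move/eqP; rewrite -subr_eq0 opprD addNKr oppr_eq0; exact/negP/oner_neq0.
have [S SM] := vn_op_algebra hM one_neq0; subst M.
have [N1 _ _] := vn_unital hN.
pose tr := re_trace (S := S) tau.
have htr : tracial_state tr by exact: re_trace_state htau.
pose EE := elt_exp NM hE.
have hEE : expectation tr EE by exact: elt_exp_expectation.
have Sa j : opa_set S (a j) by have [_ _] := hA j; apply; case: (ha j).
pose b j : op_elt S := OpElt (Sa j).
have Xb : op_of (\sum_(j < n) b j) = \sum_(j < n) a j.
  by rewrite (big_morph (@op_of _ _ _ S) (id1 := 0) (op1 := +%R)).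
have b_sa j : selfadjoint (b j) by apply: elt_star_unique; case: (ha j).
(* the partial sum before the first summand is 0, and its polynomials are scalars *)
have hindb r : poly_independent EE (fun j => r *: b j).
  move=> j q1 q2; apply: op_elt_inj => u.
  have Arb i : A i (op_of (r *: b i)).
    have [hAi _ _] := hA i; have [Ai1 Ailin _] := vn_unital hAi.
    have Ai0 : A i 0 by have := Ailin (-1) _ _ Ai1 Ai1; rewrite scaleN1r addNr.
    have [Aia _] := ha i.
    by have := Ailin r%:C _ _ Aia Ai0; rewrite addr0.
  case: (posnP j) => [j0|j0].
    rewrite big_pred0 => [|i]; last by rewrite j0.
    rewrite horner_alg0 -scalerAr mulr1 !(expZ hEE) (exp_one hEE).
    by rewrite -scalerAr mulr1.
  have [hAj _ _] := hA j.
  have := hind j j0 _ (op_of (horner_alg (\sum_(i < n | (i < j)%N) r *: b i) q2))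
    (unital_horner_alg q1 (vn_unital hAj) (Arb j)).
  move=> /(_ _)/wrap[|/(congr1 (@^~ u))]; last by [].
  move=> U [hU sub]; apply: unital_horner_alg => //; apply: unital_sum => // i ij.
  by apply: sub; exists i.
have [y1 [y1E h1]] := fun_calc_elt Num.sqrt ((\sum_(j < n) b j) * (\sum_(j < n) b j)) hM.
have [y2 [y2E h2]] := fun_calc_elt (fun t => `|t| `^ p) y1 hM.
have X_sa : is_adjoint ip (\sum_(j < n) a j) (\sum_(j < n) a j).
  rewrite -Xb; apply: sa_adjoint.
  by apply: big_ind => //; [exact: sa0 | exact: saD].
have -> : Lp_norm ip tau p (\sum_(j < n) a j) = tr y2 `^ p^-1.
  rewrite /Lp_norm /abs_pow /abs_op (adjE X_sa) /tr /re_trace y2E y1E.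
  by rewrite -Xb.
have V0 : 0 <= p * \sum_(j < n) sigma j ^+ 2.
  by rewrite mulr_ge0 ?sumr_ge0 // => [|i _]; [lra | exact: sqr_ge0].
have supM j : Mb j <= sup (range Mb).
  apply: sup_ubound; last by exists j.
  exists (\sum_(i < n) Mb i) => _ [i _ <-].
  by rewrite (bigD1 i) //= lerDl sumr_ge0 // => k _; case: (hpos k).
have supM0 : 0 <= sup (range Mb).
  have [->|/set0P[_ [j _ _]]] := eqVneq (range Mb) set0; first by rewrite sup0.
  by apply: le_trans (supM j); case: (hpos j).
(* [T0] may vanish, while [Lp_bound] divides by its parameter *)
apply/ler_addgt0Pr => e e0.
have C0 : 0 < 4 * expR 2 :> R by rewrite mulr_gt0 ?expR_gt0.
set T0 := Num.sqrt _ + _.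
have T0ge : 0 <= T0 by rewrite addr_ge0 ?sqrtr_ge0 // mulr_ge0 //; lra.
have -> : 4 * expR 2 * T0 + e = 4 * expR 2 * (T0 + e / (4 * expR 2)).
  by rewrite [RHS]mulrDr (mulrC _ (e / _)) divfK // gt_eqF.
have d0 : 0 < e / (4 * expR 2) by rewrite divr_gt0.
apply: (Lp_bound htr hEE b_sa _ _ _ hindb p2 _ _ _ h1 h2).
- by move=> j; apply: op_elt_inj => u; rewrite /= Ea.
- by move=> j; apply/op_ge0P => u; exact: (Ea2 j u).
- exact: a_nrm.
- lra.
- rewrite -(sqr_sqrtr V0) lerXn2r ?nnegrE ?sqrtr_ge0 //; first lra.
  rewrite /T0 -addrA lerDl addr_ge0 //; last lra.
  by rewrite mulr_ge0 //; lra.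
- move=> j; apply: (@le_trans _ _ T0); last lra.
  apply: (@le_trans _ _ (p * sup (range Mb))).
    by rewrite ler_wpM2l //; lra.
  by rewrite lerDr sqrtr_ge0.
Qed.
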